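(* Suppose $c > 4/3$ is the threshold for diameter 2 for some family of finite groups. Then $c \in \{\frac{4n}{3n-1} : n \in \mathbb{N}\}$ (with $\mathbb{N}$ the positive integers). Moreover, for every positive integer $n$, $\frac{4n}{3n-1}$ is the threshold for diameter 2 for the family $((C_2)^k \times D_{4n})_{k}$, where $D_{4n}$ is the dihedral group of order $4n$.
   Context: For a finite group $G$ and a subset $S \subseteq G$, the Cayley graph $\Gamma(G;S)$ has vertex set $G$ and an edge between distinct $g,h$ if and only if $hg^{-1} \in S$ or $gh^{-1} \in S$ (loops and multiple edges are ignored). The random model $\mathcal{G}(G,p)$ is the probability space of graphs $\Gamma(G;S)$ where each element of $G$ is put in $S$ independently with probability $p$. The diameter of a disconnected graph is taken to be infinite. Let $(G_k)$ be a family of finite groups of orders $n_k$ with $n_k \to \infty$. A real $c>0$ is the threshold for diameter 2 for $(G_k)$ if for every $\varepsilon>0$, with probability tending to $1$ as $k\to\infty$, $\Gamma \in \mathcal{G}(G_k,p)$ has diameter greater than 2 if $p \leqslant \sqrt{(c-\varepsilon)\frac{\log n_k}{n_k}}$ and has diameter at most 2 if $p \geqslant \sqrt{(c+\varepsilon)\frac{\log n_k}{n_k}}$. *)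

(* Defs.v *)
From HB Require Import structures.
From mathcomp Require Import all_boot all_order all_algebra.
From mathcomp Require Import all_fingroup all_solvable.
From mathcomp Require Import all_classical all_reals all_analysis.

Set Implicit Arguments.
Unset Strict Implicit.
Unset Printing Implicit Defensive.

Import Order.TTheory GRing.Theory Num.Theory.
Import numFieldNormedType.Exports.

Local Open Scope classical_set_scope.
Local Open Scope ring_scope.

(* The infimum of the empty set is +oo, so vertices in different components
   are at infinite distance. *)
Definition graph_dist (R : realType) (T : finType) (e : rel T) (x y : T)
    : \bar R :=
  ereal_inf [set (size s)%:R%:E | s in [set s : seq T | path e x s /\ last x s = y]].

Definition diameter (R : realType) (T : finType) (e : rel T) : \bar R :=
  ereal_sup [set graph_dist R e u.1 u.2 | u in [set: T * T]].

Definition cayley_graph (gT : finGroupType) (S : {set gT}) : rel gT :=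
  [rel g h : gT | (g != h) && ((h * g^-1 \in S) || (g * h^-1 \in S))%g].

(* The probability of the event E for a random subset S of T that contains each
   element independently with probability p (meaningful for 0 <= p <= 1). *)
Definition random_subset_prob (R : realType) (T : finType) (p : R)
    (E : pred {set T}) : R :=
  \sum_(S : {set T} | E S) \prod_(x : T) (if x \in S then p else 1 - p).

Definition prob_diam_le2 (R : realType) (gT : finGroupType) (p : R) : R :=
  random_subset_prob p
    (fun S : {set gT} => diameter R (cayley_graph S) <= 2%:R%:E)%E.

Definition prob_diam_gt2 (R : realType) (gT : finGroupType) (p : R) : R :=
  random_subset_prob p
    (fun S : {set gT} => 2%:R%:E < diameter R (cayley_graph S))%E.

(* The bounds on p k are only required for large k: for small k the lower bound
   sqrt ((c + eps) * log n_k / n_k) may exceed 1. *)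
Definition diam2_threshold (R : realType) (G : nat -> finGroupType) (c : R)
    : Prop :=
  [/\ #|G k| @[k --> \oo] --> \oo,
      0 < c &
      forall eps : R, 0 < eps ->
      forall p : nat -> R, (forall k, 0 <= p k <= 1) ->
        ((\forall k \near \oo,
            p k <= Num.sqrt ((c - eps) * (ln #|G k|%:R / #|G k|%:R))) ->
         prob_diam_gt2 (G k) (p k) @[k --> \oo] --> (1 : R)) /\
        ((\forall k \near \oo,
            Num.sqrt ((c + eps) * (ln #|G k|%:R / #|G k|%:R)) <= p k) ->
         prob_diam_le2 (G k) (p k) @[k --> \oo] --> (1 : R))].

(* dihedral_gtype m is the dihedral group of order m, for even m >= 4; its usual
   notation clashes with the one for directional derivatives. *)
Definition C2k_D4n (n k : nat) : finGroupType :=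
  ({dffun forall i : 'I_k, 'Z_2} * dihedral_gtype (4 * n))%type.

(* Main.v *)
Require Import Defs.
From HB Require Import structures.
From mathcomp Require Import all_boot all_order all_algebra.
From mathcomp Require Import all_fingroup all_solvable.
From mathcomp Require Import all_classical all_reals all_analysis.
From mathcomp Require Import fintype finset zify ring lra.

(* For [g <> 1], the graph joining [x] and [y] when [g] is a product of
   [x^{+-1}] and [y^{+-1}] has bounded degree, and [g] is at distance more than
   2 from [1] essentially when the random set contains no edge of it.  Adding
   the edges one at a time, this has probability [exp (- p^2 |edges| (1 + O(p)))].
   Every vertex has degree at least 2 except the solutions of [x^2 = 1], which
   have degree at least 1 (and the square roots of [g], which are harmless), so
   [|edges| >= n - i / 2] where [i] is the number of solutions of [x^2 = 1] in
   the group of order [n]; the union bound makes the diameter at most 2 above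
   [1 / (1 - i / (2 n))].  For a threshold [c > 4/3] this forces [i > n / 2].
   Then let [H] be a maximal subgroup all of whose elements satisfy [x^2 = 1]:
   at most half of the elements of any other coset of [H] do, and the proportion
   is below one half for at most one coset, whence [i / n = (m + 1) / (2 m)] and
   the central involutions have index bounded in terms of [m].  For a central
   involution equality holds in the edge count, and the second moment method
   over such [g] with edge-disjoint graphs shows that
   [1 / (1 - i / (2 n)) = 4 m / (3 m - 1)] is the threshold. *)

Set Implicit Arguments.
Unset Strict Implicit.
Unset Printing Implicit Defensive.

Import Order.TTheory GRing.Theory Num.Theory.
Import numFieldNormedType.Exports.

(** * Random subsets *)

Section RandomSubset.
Local Open Scope ring_scope.
Variables (R : realFieldType) (T : finType).
Implicit Types (w : T -> R) (p : R) (S : {set T}).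
Implicit Types (D : pred {set T}) (x : T) (e : {set T}) (F : {set {set T}}).

(** The weight may vary with the element because [Pr_decreasing_weight] changes it one coordinate at
    a time. *)
Definition wt w S : R := \prod_x (if x \in S then w x else 1 - w x).
Definition Ex w f : R := \sum_S wt w S * f S.
Definition Pr w D : R := Ex w (fun S => (D S)%:R).

Lemma wt_ge0 w S : (forall x, 0 <= w x <= 1) -> 0 <= wt w S.
Proof.
move=> w01; apply: prodr_ge0 => x _.
by have /andP[w0 w1] := w01 x; case: ifP; rewrite ?subr_ge0.
Qed.

Lemma Ex_cst w (a : R) : Ex w (fun=> a) = a.
Proof.
rewrite /Ex -mulr_suml (_ : \sum_S wt w S = 1) ?mul1r //.
transitivity (\prod_x (w x + (1 - w x))).
  by rewrite bigA_distr; apply: eq_bigl => S; rewrite inE.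
by rewrite big1 // => x _; rewrite addrC subrK.
Qed.

Lemma ler_Ex w f1 f2 : (forall x, 0 <= w x <= 1) ->
  (forall S, f1 S <= f2 S) -> Ex w f1 <= Ex w f2.
Proof.
by move=> w01 le_f; apply: ler_sum => S _; apply: ler_wpM2l; rewrite ?wt_ge0.
Qed.

Lemma ExD w f1 f2 : Ex w (fun S => f1 S + f2 S) = Ex w f1 + Ex w f2.
Proof. by rewrite /Ex -big_split; apply: eq_bigr => S _; rewrite mulrDr. Qed.

Lemma ExZ w (a : R) f : Ex w (fun S => a * f S) = a * Ex w f.
Proof. by rewrite /Ex mulr_sumr; apply: eq_bigr => S _; rewrite mulrCA. Qed.

Lemma Ex_sum w (J : finType) (A : pred J) (f : J -> {set T} -> R) :
  Ex w (fun S => \sum_(j | A j) f j S) = \sum_(j | A j) Ex w (f j).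
Proof.
rewrite /Ex exchange_big; apply: eq_bigr => S _.
by rewrite mulr_sumr.
Qed.

Lemma eq_Ex w f1 f2 : f1 =1 f2 -> Ex w f1 = Ex w f2.
Proof. by move=> eq_f; apply: eq_bigr => S _; rewrite eq_f. Qed.

Lemma eq_Pr w D1 D2 : D1 =1 D2 -> Pr w D1 = Pr w D2.
Proof. by move=> eq_D; apply: eq_Ex => S; rewrite eq_D. Qed.

Lemma Pr_ge0 w D : (forall x, 0 <= w x <= 1) -> 0 <= Pr w D.
Proof. by move=> w01; rewrite -(Ex_cst w 0); apply: ler_Ex => // S. Qed.

Lemma PrC w D : Pr w (fun S => ~~ D S) = 1 - Pr w D.
Proof.
apply/eqP; rewrite eq_sym subr_eq -ExD; apply/eqP; rewrite -[LHS](Ex_cst w).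
by apply: eq_Ex => S; case: (D S); rewrite /= ?add0r ?addr0.
Qed.

Lemma le_Pr w D1 D2 : (forall x, 0 <= w x <= 1) ->
  (forall S, D1 S -> D2 S) -> Pr w D1 <= Pr w D2.
Proof.
move=> w01 D12; apply: ler_Ex => // S; rewrite ler_nat.
by case: (D1 S) (D12 S) => // ->.
Qed.

Lemma Pr_exists w (J : finType) (D : J -> pred {set T}) (A : pred J) :
  (forall x, 0 <= w x <= 1) ->
  Pr w (fun S => [exists j, A j && D j S]) <= \sum_(j | A j) Pr w (D j).
Proof.
move=> w01; rewrite -(Ex_sum w A (fun j S => (D j S)%:R)); apply: ler_Ex => // S.
case: existsP => [[j /andP[Aj Dj]]|_]; last first.
  by apply: sumr_ge0 => j _; apply: ler0n.
rewrite (bigD1 j) //= Dj lerDl; apply: sumr_ge0 => i _; exact: ler0n.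
Qed.

(** Conditioning on all elements but [x]: each [S] avoiding [x] is paired with [x |: S]. *)
Lemma Ex_split w x f :
  Ex w f = \sum_(S : {set T} | x \notin S) (\prod_(y | y != x) (if y \in S then w y else 1 - w y))
    * ((1 - w x) * f S + w x * f (x |: S)).
Proof.
rewrite /Ex (bigID [pred S : {set T} | x \notin S]) /= addrC.
rewrite (reindex_onto (fun S : {set T} => x |: S) (fun S => S :\ x)) /=; last first.
  by move=> S; rewrite negbK => xS; rewrite setD1K.
rewrite (eq_bigl (fun S : {set T} => x \notin S)); last first.
  move=> S; rewrite setU11 /=; apply/eqP/idP => [<-|xS]; first by rewrite !inE eqxx.
  by rewrite setU1K.
rewrite -big_split; apply: eq_bigr => S xS /=.
rewrite /wt !(bigD1 x (P := predT)) //= setU11 (negPf xS).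
under eq_bigr => y /negPf yx do rewrite !inE yx /=.
by rewrite mulrDr addrC; congr (_ + _); rewrite mulrCA mulrA; congr (_ * _); rewrite mulrC.
Qed.

(** * Correlation and monotonicity for decreasing events *)

Definition decreasing D := forall S1 S2, S1 \subset S2 -> D S2 -> D S1.

(** For decreasing [D] and [y] other than [x], this still holds of [(y \in S) && D S], which need
    not be decreasing. *)
Definition decreasing_at x D := forall S, D (x |: S) -> D S.

Lemma decreasingW x D : decreasing D -> decreasing_at x D.
Proof. by move=> decD S; apply: decD; rewrite subsetUr. Qed.

Lemma prod_weight_ge0 w x S : (forall x, 0 <= w x <= 1) ->
  0 <= \prod_(y | y != x) (if y \in S then w y else 1 - w y).
Proof.
move=> w01; apply: prodr_ge0 => y _.
by have /andP[w0 w1] := w01 y; case: ifP; rewrite ?subr_ge0.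
Qed.

(** The simplest case of Harris' inequality: once the rest of [S] is fixed, [D] with [x] present
    implies [D] with [x] absent. *)
Lemma Pr_mem_le w x D : (forall x, 0 <= w x <= 1) -> decreasing_at x D ->
  Pr w (fun S => (x \in S) && D S) <= w x * Pr w D.
Proof.
move=> w01 decD; rewrite /Pr !(Ex_split w x) mulr_sumr; apply: ler_sum => S xS.
rewrite mulrCA; apply: ler_wpM2l; first exact: prod_weight_ge0.
rewrite (negPf xS) setU11 /= mulr0 add0r; have /andP[w0 w1] := w01 x.
apply: ler_wpM2l => //.
case: (D _) (decD S) => [->//|_]; first by rewrite !mulr1 subrK.
by rewrite mulr0 addr0 mulr_ge0 ?subr_ge0.
Qed.

Lemma Pr_mem_indep w x D : (forall S, D (x |: S) = D S) ->
  Pr w (fun S => (x \in S) && D S) = w x * Pr w D.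
Proof.
move=> indD; rewrite /Pr !(Ex_split w x) mulr_sumr; apply: eq_bigr => S xS.
rewrite mulrCA (negPf xS) setU11 /= indD mulr0 add0r -mulrDl subrK mul1r.
by [].
Qed.

Lemma Pr_notin_ge w x D : (forall x, 0 <= w x <= 1) -> decreasing_at x D ->
  (1 - w x) * Pr w D <= Pr w (fun S => (x \notin S) && D S).
Proof.
move=> w01 decD; have := Pr_mem_le w01 decD.
have -> : Pr w (fun S => (x \notin S) && D S)
          = Pr w D - Pr w (fun S => (x \in S) && D S).
  apply/eqP; rewrite eq_sym subr_eq -ExD; apply/eqP; apply: eq_Ex => S.
  by case: (x \in S); rewrite /= ?add0r ?addr0.
lra.
Qed.

Lemma Pr_decreasing_weight w1 w2 D :
  (forall x, 0 <= w1 x <= 1) -> (forall x, 0 <= w2 x <= 1) ->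
  (forall x, w1 x <= w2 x) -> decreasing D -> Pr w2 D <= Pr w1 D.
Proof.
move=> w1P w2P w12 decD.
(* Induction on a list of the coordinates where the weights may differ; one step replaces [w1] by
   [w2] at [x] alone. *)
suff: forall s : seq T, (forall x, x \notin s -> w1 x = w2 x) -> Pr w2 D <= Pr w1 D.
  by move=> /(_ (enum T)); apply => x; rewrite mem_enum.
move=> s; elim: s w1 w1P w12 => [|x s IHs] w1 w1P w12 eqw.
  suff -> : Pr w2 D = Pr w1 D by [].
  apply: eq_bigr => S _; congr (_ * _); apply: eq_bigr => x _.
  by rewrite eqw.
pose w y := if y == x then w2 y else w1 y.
have wP y : 0 <= w y <= 1 by rewrite /w; case: eqP.
apply: (@le_trans _ _ (Pr w D)).
  apply: IHs => // [y|y ys]; rewrite /w; case: eqVneq => // yx.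
  by apply: eqw; rewrite inE negb_or yx.
rewrite /Pr !(fun v => Ex_split v x); apply: ler_sum => S xS.
have -> : \prod_(y | y != x) (if y \in S then w y else 1 - w y)
   = \prod_(y | y != x) (if y \in S then w1 y else 1 - w1 y).
  by apply: eq_bigr => y /negPf yx; rewrite /w yx.
apply: ler_wpM2l; first exact: prod_weight_ge0.
rewrite /w eqxx; have := w12 x; case: (D (x |: S)) (@decD S (x |: S) (subsetUr _ _)).
  by move=> ->// _; rewrite !mulr1 !subrK.
by move=> _ le_w; rewrite !mulr0 !addr0; apply: ler_wpM2r; rewrite ?ler0n // lerB.
Qed.

(** Chebyshev's inequality for the number [N] of events that hold, of mean [A]: its variance is at
    most [A + (rho - 1) * A ^ 2], and [N = 0] is a deviation of [A]. *)
Lemma second_moment w (J : finType) (X : {set J}) (D : J -> pred {set T}) (rho : R) :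
  (forall x, 0 <= w x <= 1) -> 1 <= rho ->
  {in X &, forall i j, i != j ->
     Pr w (fun S => D i S && D j S) <= rho * (Pr w (D i) * Pr w (D j))} ->
  0 < \sum_(j in X) Pr w (D j) ->
  Pr w (fun S => ~~ [exists j in X, D j S])
    <= rho - 1 + (\sum_(j in X) Pr w (D j))^-1.
Proof.
move=> w01 rho1 pairs; set A := \sum_(j in X) _ => A0.
pose N S : R := \sum_(j in X) (D j S)%:R.
have EN : Ex w N = A by rewrite /N (Ex_sum w (mem X)).
have EN2 : Ex w (fun S => N S * N S) <= A + rho * (A * A).
  have -> : Ex w (fun S => N S * N S)
      = \sum_(i in X) \sum_(j in X) Pr w (fun S => D i S && D j S).
    transitivity (Ex w (fun S => \sum_(i in X) \sum_(j in X) (D i S && D j S)%:R)).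
      apply: eq_Ex => S; rewrite big_distrlr /=.
      by apply: eq_bigr => i _; apply: eq_bigr => j _; rewrite -natrM mulnb.
    by rewrite (Ex_sum w (mem X)); apply: eq_bigr => i _; exact: (Ex_sum w (mem X)).
  have -> : rho * (A * A) = \sum_(i in X) \sum_(j in X) rho * (Pr w (D i) * Pr w (D j)).
    by rewrite big_distrlr mulr_sumr; apply: eq_bigr => i _; rewrite mulr_sumr.
  rewrite /A -big_split; apply: ler_sum => i Xi /=.
  (* The diagonal term is at most [Pr w (D i)]; its nonnegative counterpart on the right only
     completes the double sum. *)
  rewrite (bigD1 i) //= [X in _ <= _ + X](bigD1 i) //= addrA; apply: lerD.
    rewrite -[leLHS]addr0; apply: lerD; first by apply: le_Pr => // S /andP[].
    by rewrite !mulr_ge0 ?Pr_ge0 // (le_trans ler01).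
  by apply: ler_sum => j /andP[Xj ij]; apply: pairs; rewrite // eq_sym.
rewrite -(ler_pM2r (mulr_gt0 A0 A0)) mulrDl [X in _ + X]mulrA mulVf ?gt_eqF // mul1r.
apply: (@le_trans _ _ (Ex w (fun S => (N S - A) * (N S - A)))).
  rewrite mulrC -ExZ; apply: ler_Ex => // S.
  have [_|none] := boolP [exists j in X, D j S]; rewrite /= ?mulr0 -?expr2 ?sqr_ge0 //.
  suff -> : N S = 0 by rewrite sub0r sqrrN mulr1.
  apply: big1 => j Xj; case: (boolP (D j S)) => // Dj.
  by case/negP: none; apply/existsP; exists j; rewrite Xj.
have -> : Ex w (fun S => (N S - A) * (N S - A)) =
    Ex w (fun S => N S * N S) - A * A.
  rewrite (eq_Ex w (f2 := fun S => N S * N S + ((- (A + A)) * N S + A * A))); last first.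
    by move=> S; ring.
  rewrite !ExD Ex_cst (ExZ w (- (A + A)) N) EN; ring.
by move: EN2; rewrite mulrBl mul1r; lra.
Qed.

(** * Independent sets of a bounded-degree graph, for constant probability *)

Section Uniform.
Variable p : R.
Hypothesis p01 : 0 <= p <= 1.
Local Notation P := (Pr (fun=> p)).

Let w01 (x : T) : 0 <= (fun=> p) x <= 1 := p01.


Lemma Pr_disjoint (A : {set T}) : P (fun S => [disjoint A & S]) = (1 - p) ^+ #|A|.
Proof.
elim: {A}_.+1 {-2}A (ltnSn #|A|) => // n IHn A; rewrite ltnS => leAn.
have [->|[x xA]] := set_0Vmem A.
  rewrite cards0 expr0 -[RHS](Ex_cst (fun=> p)); apply: eq_Ex => S.
  by rewrite -setI_eq0 set0I eqxx.
rewrite (cardsD1 x A) xA exprS -IHn; last first.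
  by rewrite (cardsD1 x A) xA in leAn.
have := @Pr_mem_indep (fun=> p) x (fun S => [disjoint A :\ x & S]).
have -> : P (fun S => [disjoint A & S]) = P (fun S => [disjoint A :\ x & S])
    - P (fun S => (x \in S) && [disjoint A :\ x & S]).
  apply/eqP; rewrite eq_sym subr_eq -ExD; apply/eqP; apply: eq_Ex => S.
  rewrite -{2}(setD1K xA) -!setI_eq0 setIUl setU_eq0 [_ :&: S == _ as X in X && _]setI_eq0.
  rewrite disjoints1; case: (x \in S); rewrite /= ?add0r ?addr0 //.
move->; first by rewrite mulrBl mul1r.
move=> S; rewrite -!setI_eq0 setIUr; congr (_ == _).
by apply/setP => y; rewrite !inE; case: eqVneq; rewrite /= ?andbF.
Qed.

Definition free F S := [forall e in F, ~~ (e \subset S)].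

Lemma free_decreasing F : decreasing (free F).
Proof.
move=> S1 S2 S12 /forall_inP free2; apply/forall_inP => e /free2.
by apply: contra => /subset_trans; apply.
Qed.

Lemma freeU1 e F S : free (e |: F) S = ~~ (e \subset S) && free F S.
Proof.
apply/forall_inP/andP => [H|[He /forall_inP HF] f].
  split; first by apply: H; rewrite setU11.
  by apply/forall_inP => f Ff; apply: H; rewrite setU1r.
by case/setU1P=> [->|/HF].
Qed.

Lemma Pr_freeU1 e F : P (free (e |: F)) = P (free F) - P (fun S => (e \subset S) && free F S).
Proof.
apply/eqP; rewrite eq_sym subr_eq -ExD; apply/eqP; apply: eq_Ex => S.
by rewrite freeU1; case: (e \subset S); rewrite /= ?add0r ?addr0.
Qed.

Lemma Pr_subset_le e D : #|e| = 2 -> decreasing D ->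
  P (fun S => (e \subset S) && D S) <= p ^+ 2 * P D.
Proof.
move=> /eqP/cards2P[x [y [xy ->]]] decD.
have := @Pr_mem_le (fun=> p) x (fun S => (y \in S) && D S) w01.
have := @Pr_mem_le (fun=> p) y D w01 (decreasingW decD).
have -> : P (fun S => ([set x; y] \subset S) && D S) =
          P (fun S => (x \in S) && ((y \in S) && D S)).
  by apply: eq_Pr => S; rewrite subUset !sub1set andbA.
move=> h1 h2; apply: le_trans (h2 _) _.
  move=> S /andP[]; rewrite in_setU1 eq_sym (negPf xy) /= => -> /=.
  exact: decreasingW.
by rewrite expr2 -mulrA; apply: ler_wpM2l => //; case/andP: p01.
Qed.

Lemma Pr_subset_indep e D : #|e| = 2 ->
  (forall x S, x \in e -> D (x |: S) = D S) ->
  P (fun S => (e \subset S) && D S) = p ^+ 2 * P D.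
Proof.
move=> /eqP/cards2P[x [y [xy ->]]] indD.
have -> : P (fun S => ([set x; y] \subset S) && D S) =
          P (fun S => (x \in S) && ((y \in S) && D S)).
  by apply: eq_Pr => S; rewrite subUset !sub1set andbA.
rewrite Pr_mem_indep ?Pr_mem_indep 1?expr2 -1?mulrA // => S.
  by rewrite indD // !inE eqxx orbT.
by rewrite in_setU1 eq_sym (negPf xy) /= indD // !inE eqxx.
Qed.

(** Edges are added one at a time: by [Pr_subset_le], containing the new edge is negatively
    correlated with avoiding the old ones, so each edge costs at most a factor [1 - p ^ 2]. *)
Lemma Pr_free_ge F : {in F, forall e, #|e| = 2} -> (1 - p ^+ 2) ^+ #|F| <= P (free F).
Proof.
have p2 : 0 <= 1 - p ^+ 2 by have /andP[p0 p1] := p01; nra.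
elim: {F}_.+1 {-2}F (ltnSn #|F|) => // n IHn F; rewrite ltnS => leFn F2.
have [->|[e Fe]] := set_0Vmem F.
  rewrite cards0 expr0 -[leLHS](Ex_cst (fun=> p)); apply: ler_Ex => // S.
  by have -> : free set0 S by apply/forall_inP => e; rewrite inE.
rewrite -{1 2}(setD1K Fe) cardsU1 !inE eqxx /= Pr_freeU1 add1n [leLHS]exprS.
have le_F : (#|F :\ e| < n)%N by rewrite (cardsD1 e) Fe in leFn.
have := IHn _ le_F; have := Pr_subset_le (F2 _ Fe) (@free_decreasing (F :\ e)).
move=> h1 /(_ _) h2; rewrite -[X in _ <= X - _]mul1r.
apply: (@le_trans _ _ ((1 - p ^+ 2) * P (free (F :\ e)))).
  by apply: ler_wpM2l => //; apply: h2 => f; rewrite inE => /andP[_ /F2].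
by rewrite mulrBl lerD2l lerN2.
Qed.

(* The edges of [F] meeting [e] are kept out of [S] by removing one endpoint
   of each of them; since the rest of [F] is a decreasing event, this costs at
   most a factor [1 - K p]. *)
Lemma Pr_freeU1_le (K : nat) e F :
  {in e |: F, forall f : {set T}, #|f| = 2} -> e \notin F ->
  (#|[set f in F | ~~ [disjoint e & f]]| <= K)%N -> K%:R * p <= 1 ->
  P (free (e |: F)) <= (1 - p ^+ 2 * (1 - K%:R * p)) * P (free F).
Proof.
move=> F2 eF leK Kp.
have /andP[p0 p1] := p01.
(* [N] consists of the edges meeting [e]. Such an [f] differs from [e] and both have two elements,
   so [o f] is an endpoint of [f] outside [e]; [W] collects these endpoints. *)
pose N := [set f in F | ~~ [disjoint e & f]].
pose B := free (F :\: N).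
have e2 : #|e| = 2 by apply: F2; rewrite setU11.
pose o f := if [pick x in f :\: e] is Some x then [set x] else set0.
pose W := \bigcup_(f in N) o f.
have oP f : f \in N -> exists x, [/\ o f = [set x], x \in f & x \notin e].
  rewrite inE => /andP[Ff _]; rewrite /o; case: pickP => [x|out].
    by rewrite inE => /andP[xe xf]; exists x.
  case/negP: eF; suff -> : e = f by [].
  apply/eqP; rewrite eq_sym eqEcard e2 F2 ?setU1r // andbT.
  by apply/subsetP => x xf; have := out x; rewrite !inE xf andbT => /negbFE.
have We x : x \in W -> x \notin e.
  by case/bigcupP => f /oP[y [-> _ ye]]; rewrite inE => /eqP ->.
have cW : (#|W| <= K)%N.
  apply: leq_trans leK; rewrite -/N -[leqRHS]sum1_card /W.
  apply: (big_ind2 (fun (A : {set T}) n => #|A| <= n)%N) => [|A1 n1 A2 n2 h1 h2|f].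
  - by rewrite cards0.
  - by apply: leq_trans (leq_card_setU _ _) _; apply: leq_add.
  - by move=> /oP[y [-> _ _]]; rewrite cards1.
rewrite Pr_freeU1.
suff : p ^+ 2 * (1 - K%:R * p) * P (free F) <= P (fun S => (e \subset S) && free F S).
  by rewrite mulrBl mul1r lerD2l lerN2.
apply: (@le_trans _ _ (P (fun S => (e \subset S) && (B S && [disjoint W & S])))); last first.
  apply: le_Pr => // S /and3P[eS BS dS]; rewrite eS /=; apply/forall_inP => f Ff.
  have [Nf|Nf] := boolP (f \in N); last first.
    by apply: (forall_inP BS); rewrite !inE Ff andbT in Nf *.
  have [y [oy yf _]] := oP _ Nf; apply: contraL dS => /subsetP/(_ _ yf) yS.
  rewrite -setI_eq0; apply/set0Pn; exists y; rewrite inE yS andbT.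
  by apply/bigcupP; exists f => //; rewrite oy inE.
(* Neither [W] nor the edges outside [N] meet [e], so containing [e] is independent of the rest. *)
rewrite Pr_subset_indep //; last first.
  move=> x S xe; congr (_ && _).
    apply: eq_forallb_in => f; rewrite !inE => /andP[Nf Ff]; rewrite Ff /= negbK in Nf.
    congr negb; apply/subsetP/subsetP => sub y yf; have := sub y yf; rewrite !inE.
      by case/predU1P=> // yx; rewrite -yx in xe; rewrite (disjointFr Nf xe) in yf.
    by move=> ->; rewrite orbT.
  rewrite -!setI_eq0 setIUr; suff -> : W :&: [set x] = set0 by rewrite set0U.
  apply/setP => y; rewrite !inE; apply/negP => /andP[/We + /eqP yx].
  by rewrite yx xe.
rewrite -mulrA; apply: ler_wpM2l; first exact: exprn_ge0.
apply: (@le_trans _ _ ((1 - K%:R * p) * P B)).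
  apply: ler_wpM2l; first by rewrite subr_ge0.
  apply: le_Pr => // S /forall_inP frF; apply/forall_inP => f.
  by rewrite inE => /andP[_ /frF].
have -> : P (fun S => B S && [disjoint W & S]) =
  P B - P (fun S => B S && ~~ [disjoint W & S]).
  apply/eqP; rewrite eq_sym subr_eq -ExD; apply/eqP; apply: eq_Ex => S.
  by case: (B S); case: [disjoint W & S]; rewrite /= ?add0r ?addr0.
suff : P (fun S => B S && ~~ [disjoint W & S]) <= K%:R * p * P B by rewrite mulrBl mul1r lerD2l lerN2.
apply: (@le_trans _ _ (P (fun S => [exists x, (x \in W) && ((x \in S) && B S)]))).
  apply: le_Pr => // S /andP[BS]; rewrite -setI_eq0 => /set0Pn[x].
  by rewrite inE => /andP[xW xS]; apply/existsP; exists x; rewrite xW xS.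
apply: le_trans (Pr_exists _ _ w01) _.
apply: (@le_trans _ _ (\sum_(x in W) p * P B)).
  apply: ler_sum => x _; apply: Pr_mem_le => //; exact: decreasingW (@free_decreasing _).
rewrite sumr_const -[_ *+ #|W|]mulr_natl -mulrA; apply: ler_wpM2r.
  by rewrite mulr_ge0 // Pr_ge0.
by rewrite ler_nat.
Qed.

(** Each endpoint of an edge lies in at most [K] edges, so at most [K.*2] edges meet it;
    [Pr_freeU1_le] is applied to the edges one by one. *)
Lemma Pr_free_le (K : nat) F : {in F, forall e, #|e| = 2} ->
  (forall x, (#|[set f in F | x \in f]| <= K)%N) -> (K.*2)%:R * p <= 1 ->
  P (free F) <= (1 - p ^+ 2 * (1 - (K.*2)%:R * p)) ^+ #|F|.
Proof.
have /andP[p0 p1] := p01.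
move=> + + Kp; elim: {F}_.+1 {-2}F (ltnSn #|F|) => // n IHn F; rewrite ltnS => leFn F2 dF.
have [->|[e Fe]] := set_0Vmem F.
  rewrite cards0 expr0 -[leRHS](Ex_cst (fun=> p)); apply: ler_Ex => // S.
  by rewrite lern1 leq_b1.
have le_F : (#|F :\ e| < n)%N by rewrite (cardsD1 e) Fe in leFn.
rewrite -{1 2}(setD1K Fe) cardsU1 !inE eqxx add1n [leRHS]exprS.
apply: le_trans (Pr_freeU1_le (K := K.*2) _ _ _ Kp) _; rewrite ?setD1K //.
- by rewrite !inE eqxx.
- have /eqP/cards2P[x [y [_ ->]]] := F2 _ Fe.
  apply: leq_trans (_ : #|[set f in F | x \in f] :|: [set f in F | y \in f]| <= _)%N.
    apply/subset_leq_card/subsetP => f; rewrite !inE => /andP[/andP[_ ->]].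
    by rewrite -setI_eq0 => /set0Pn[z]; rewrite !inE => /andP[/orP[]/eqP -> ->]; rewrite ?orbT.
  by apply: leq_trans (leq_card_setU _ _) _; rewrite -addnn leq_add.
apply: ler_wpM2l.
  suff : p ^+ 2 * (1 - (K.*2)%:R * p) <= 1 by rewrite subr_ge0.
  have Kp0 : 0 <= (K.*2)%:R * p by rewrite mulr_ge0 ?ler0n.
  by apply: mulr_ile1; rewrite ?exprn_ge0 ?exprn_ile1 ?subr_ge0 // gerBl.
apply: IHn => // [f|x]; first by rewrite inE => /andP[_ /F2].
apply: leq_trans (dF x); apply/subset_leq_card/subsetP => f; rewrite !inE.
by case/andP=> /andP[_ ->].
Qed.

End Uniform.

End RandomSubset.

(** * Groups with many involutions *)

Section Involutions.
Local Open Scope group_scope.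
Variable gT : finGroupType.
Implicit Types (x y t : gT) (H K : {group gT}).

(* Unlike the usual involutions, this includes the identity. *)
Definition invols : {set gT} := [set x | x ^+ 2 == 1].

Definition central_invols : {set gT} := 'Z([set: gT]) :&: invols.

Lemma involsP x : reflect (x * x = 1) (x \in invols).
Proof. by rewrite inE expgS expg1; apply: eqP. Qed.

Lemma invols_inv x : x \in invols -> x^-1 = x.
Proof. by move/involsP => xx; apply/eqP; rewrite eq_invg_mul xx. Qed.

Lemma invols_mul x y : x \in invols -> y \in invols ->
  (x * y \in invols) = (x * y == y * x).
Proof.
move=> Ix Iy; apply/involsP/eqP => [xy1|xy].
  have := invols_inv (introT (involsP _) xy1).
  by rewrite invMg !invols_inv.
by rewrite {2}xy mulgA -(mulgA x y y) (involsP _ Iy) mulg1 (involsP _ Ix).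
Qed.

Lemma sub_invols_abelian H : H \subset invols -> abelian H.
Proof.
move=> /subsetP HI; apply/centsP => x Hx y Hy; apply/eqP.
by rewrite -invols_mul ?HI ?groupM.
Qed.

Lemma sub_invols_pgroup H : H \subset invols -> 2.-group H.
Proof.
move=> /subsetP HI; rewrite -pnat_exponent.
apply: (@pnat_dvd _ 2) => //; apply/exponentP => x Hx.
by have := HI _ Hx; rewrite inE => /eqP.
Qed.

(** By [invols_mul], [x * t] with [x] in [H] has square 1 exactly when [x] commutes with [t]. *)
Lemma rcoset_invols H t : H \subset invols -> t \in invols ->
  (H :* t) :&: invols = 'C_H[t] :* t.
Proof.
move=> /subsetP HI It; apply/setP => y; rewrite in_setI !mem_rcoset in_setI.
case: (boolP (_ \in H)) => //= Hyt.
rewrite -{1}(mulgKV t y) invols_mul ?(HI _ Hyt) //; apply/eqP/cent1P => //.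
Qed.

(** If [t] centralized [H], then [H <*> <[t]>] would be a larger group inside [invols]. *)
Lemma maximal_cent_proper H t :
  maxgroup H (fun K => K \subset invols) -> t \in invols -> t \notin H ->
  'C_H[t] \proper H.
Proof.
case/maxgroupP => HI maxH It; apply: contraNT; rewrite properE subsetIl negbK.
rewrite subsetI subxx sub_cent1 => tC.
have cK : <[t]> \subset 'C(H) by rewrite cycle_subG.
suff /maxH : H <*> <[t]> \subset invols.
  by move=> /(_ (joing_subl _ _)) <-; rewrite (subsetP (joing_subr _ _)) ?cycle_id.
rewrite cent_joinEr //; apply/subsetP => _ /mulsgP[x _ Hx /cycleP[i ->] ->].
have := subsetP HI _ Hx; rewrite !inE => /eqP x2.
rewrite expgMn ?x2 ?mul1g -?expgM 1?mulnC ?expgM; last first.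
  by apply/commute_sym/(centsP cK); rewrite ?mem_cycle.
by move: It; rewrite inE => /eqP ->; rewrite expg1n.
Qed.

(** [K] is the common centralizer in [H] of the elements of [s]; each of them multiplies the index
    by at most [d]. *)
Lemma cent_seq_card H (s : seq gT) (d : nat) :
  {in s, forall t, #|H| <= d * #|'C_H[t]|}%N ->
  exists K, [/\ K \subset H, {in s, forall t, t \in 'C(K)} & #|H| <= d ^ size s * #|K|]%N.
Proof.
elim: s => [|t s IHs] sP; first by exists H; split; rewrite ?mul1n.
have [u us|K [KH Ks cK]] := IHs; first by apply: sP; rewrite inE us orbT.
exists ('C_K[t])%G; split=> [|u|] /=; first exact: subset_trans (subsetIl _ _) KH.
  rewrite inE => /predU1P[->|/Ks uK]; first by rewrite -sub_cent1 subsetIr.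
  by apply: subsetP uK; apply: centS; apply: subsetIl.
have := sP t (mem_head _ _).
have := mul_cardG K 'C_H[t]; have : #|K * 'C_H[t]| <= #|H|.
  by apply: subset_leq_card; rewrite mul_subG ?subsetIl.
rewrite setIA (setIidPl KH) expnS => h1 h2 h3.
have H0 := cardG_gt0 H; rewrite -(leq_pmul2r H0).
apply: leq_trans (_ : d ^ size s * #|K| * #|H| <= _); first by rewrite leq_mul2r cK orbT.
apply: leq_trans (_ : d ^ size s * (#|K| * (d * #|'C_H[t]|)) <= _).
  by rewrite -mulnA !leq_mul2l h3 !orbT.
have h4 : (#|K| * #|'C_H[t]| <= #|H| * #|'C_K[t]|)%N by rewrite h2 leq_mul2r h1 orbT.
have := leq_mul (leqnn (d ^ size s * d)) h4.
move: (d ^ size s)%N #|K| #|'C_H[t]| #|H| #|'C_K[t]| => *; lia.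
Qed.

(* Every coset of a maximal subgroup [H] of involutions, other than [H], meets
   the involutions in [0] or in at most half of its elements, and the half is
   missed at most once, since otherwise the average would be at most [1/2]. *)
Lemma many_invols : (#|gT| < 2 * #|invols|)%N ->
  exists m, [/\ 0 < m, 2 * m * #|invols| = m.+1 * #|gT|
    & #|gT| <= m * (2 * m) ^ m * #|central_invols|]%N.
Proof.
move=> half.
have [H maxH] : {H : {group gT} | maxgroup H (fun K : {group gT} => K \subset invols)}.
  by apply: ex_maxgroup; exists 1%G; rewrite sub1set inE expg1n.
have HI : H \subset invols by case/maxgroupP: (maxH).
pose G := [set: gT]%G; pose P := rcosets H G.
pose phi (C : {set gT}) := #|C :&: invols|.
have partP : partition P G by apply: rcosets_partition; rewrite subsetT.
have PH : (H : {set gT}) \in P by apply/rcosetsP; exists 1; rewrite ?inE // rcoset1.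
have sumI : #|invols| = (#|H| + \sum_(C in P :\ (H : {set gT})) phi C)%N.
  have -> : #|invols| = (\sum_(x in G) (x \in invols))%N.
    by rewrite -sum1_card big_mkcond; apply: eq_big => [x|x _]; rewrite ?inE //; case: ifP.
  rewrite (set_partition_big _ partP) (big_setD1 (H : {set gT})) //=; congr (_ + _)%N.
    rewrite -sum1_card; apply: eq_bigr => x Hx; by rewrite (subsetP HI).
  apply: eq_bigr => C _; rewrite /phi -sum1_card [RHS]big_mkcond [LHS]big_mkcond.
  by apply: eq_bigr => x _; rewrite !in_setI; case: (x \in C); case: (x \in invols).
have cardG : #|gT| = (#|P :\ (H : {set gT})|.+1 * #|H|)%N.
  rewrite -cardsT -(LagrangeI G H) setTI mulnC; congr (_ * _)%N.
  rewrite -[#|G : H|]/(#|P|) (cardsD1 (H : {set gT})) PH //.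
pose h := #|H|.
have h0 : (0 < h)%N := cardG_gt0 H.
(* The proper subgroup ['C_H[t]] of the 2-group [H] has index [2 ^ i] with [i > 0], so a coset other
   than [H] meets [invols] in proportion 0 or [1 / 2 ^ i]. *)
have cosetP C : C \in P :\ (H : {set gT}) -> (0 < phi C)%N ->
    exists t i, [/\ t \in C :&: invols, phi C = #|'C_H[t]|, (0 < i)%N
      & h = (2 ^ i * #|'C_H[t]|)%N].
  rewrite !inE => /andP[CH /rcosetsP[x _ defC]]; rewrite card_gt0 => /set0Pn[t tC].
  exists t; have /setIP[Ct It] := tC.
  have defCt : C = H :* t by rewrite defC; apply/esym/rcoset_eqP; rewrite -defC.
  have tH : t \notin H by apply: contra CH => tH; rewrite defCt rcoset_id.
  have /p_natP[i iE] : 2.-nat #|H : 'C_H[t]|.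
    by apply: pnat_dvd (sub_invols_pgroup HI); apply: dvdn_indexg.
  have hE : h = (2 ^ i * #|'C_H[t]|)%N by rewrite -iE mulnC Lagrange // subsetIl.
  exists i; split=> //.
  - by rewrite /phi defCt rcoset_invols // card_rcoset.
  - case: i iE hE => // iE hE; have := proper_card (maximal_cent_proper maxH It tH).
    by rewrite -/h hE mul1n ltnn.
have phiP C : C \in P :\ (H : {set gT}) -> (2 * phi C = h \/ 4 * phi C <= h)%N.
  move=> PC; have [->|/(cosetP _ PC)[t [[|[|i]] [_ -> // _ ->]]]] := posnP (phi C).
  - by right.
  - by left.
  - by right; rewrite !expnS; nia.
pose Bad := [set C in P :\ (H : {set gT}) | 2 * phi C != h]%N.
have BadP : Bad \subset P :\ (H : {set gT}) by apply/subsetP => C; rewrite inE => /andP[].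
have good C : C \in (P :\ (H : {set gT})) :\: Bad -> (2 * phi C = h)%N.
  by rewrite !inE => /andP[+ PC]; rewrite PC /= negbK => /eqP.
have sum2 : (2 * #|invols| = 2 * h + (#|P :\ (H : {set gT})| - #|Bad|) * h
     + \sum_(C in Bad) 2 * phi C)%N.
  rewrite sumI mulnDr -addnA; congr (_ + _)%N.
  rewrite big_distrr (big_setID Bad) /= (setIidPr BadP) addnC; congr (_ + _)%N.
  rewrite (eq_bigr (fun=> h)) ?sum_nat_const; last by move=> C /good.
  by rewrite cardsD (setIidPr BadP).
have leBad := subset_leq_card BadP.
have bad_le : (2 * (\sum_(C in Bad) 2 * phi C) <= #|Bad| * h)%N.
  rewrite big_distrr -sum_nat_const; apply: leq_sum => C.
  by rewrite inE => /andP[/phiP]; rewrite /=; lia.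
(* Compared with one half, [H] gains [h / 2] and each bad coset loses at least [h / 4], so two bad
   cosets would bring the total down to at most half of the group. *)
have bad1 : (#|Bad| < 2)%N.
  rewrite -/h in cardG; move: cardG half sum2 leBad bad_le h0.
  move: #|P :\ _| #|Bad| (\sum_(C in Bad) _)%N #|gT| #|invols| (h) => j b s n I0 h'.
  move=> -> half sum2 leb bad_le h0; rewrite ltnNge; apply/negP => b2.
  have : ((j - b) * h' + b * h' = j * h')%N by rewrite -mulnDl subnK.
  have : (2 * h' <= b * h')%N by rewrite leq_mul2r b2 orbT.
  move: half sum2 bad_le; rewrite mulSn.
  by move: ((j - b) * h')%N (b * h')%N (j * h')%N => A B J; lia.
(* Without a bad coset, [m] is the index of [H]; with one, of proportion [1 / (4 * i')], it is the
   index times [2 * i']. *)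
have [m [m0 jm mE phim]] : exists m, [/\ (0 < m)%N, (#|P :\ (H : {set gT})| < m)%N,
    (2 * m * #|invols| = m.+1 * #|gT|)%N
    & forall C, C \in P :\ (H : {set gT}) -> (0 < phi C)%N /\ (h <= 2 * m * phi C)%N].
  case: (posnP #|Bad|) => [/eqP|Bad0].
    rewrite cards_eq0 => /eqP B0; exists (#|P :\ (H : {set gT})|).+1; split=> //.
      by move: sum2; rewrite B0 big_set0 cards0 cardG -/h; nia.
    move=> C PC; have : (2 * phi C = h)%N by apply: good; rewrite B0 setD0.
    by move: h0; nia.
  have /eqP/cards1P[C1 BadE] : #|Bad| = 1%N by lia.
  rewrite BadE big_set1 cards1 in sum2 leBad.
  (* If the bad coset missed [invols], exactly half of the group would have square 1. *)
  have phi0 : (0 < phi C1)%N.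
    by move: half; rewrite sum2 cardG -/h; nia.
  have PC1 : C1 \in P :\ (H : {set gT}) by apply: (subsetP BadP); rewrite BadE set11.
  have [t [i [_ phiE i0 hE]]] := cosetP _ PC1 phi0.
  have i1 : (1 < i)%N.
    have : C1 \in Bad by rewrite BadE set11.
    rewrite inE PC1 /= hE phiE; case: i i0 {hE} => // -[] // _; by rewrite eqxx.
  have [i' iE] : exists i', (2 ^ i = 2 * (2 * i'))%N.
    by exists (2 ^ (i - 2))%N; rewrite -!expnS; congr (2 ^ _)%N; lia.
  have i'0 : (0 < i')%N by case: i' iE => // /eqP; rewrite muln0 expn_eq0.
  rewrite -phiE iE in hE.
  move: sum2 cardG leBad; rewrite -/h; set j := #|P :\ _| => sum2 cardG leBad.
  have sum2' : (2 * #|invols| = j.+1 * h + 2 * phi C1)%N.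
    rewrite sum2; case: (j) leBad => // j' _; rewrite subSS subn0; nia.
  exists (j.+1 * (2 * i'))%N; split=> //.
  - by rewrite !muln_gt0 i'0.
  - nia.
  - rewrite cardG mulnAC sum2' hE; nia.
  - move=> C PC; have [CBad|CBad] := boolP (C \in Bad).
      by move: CBad; rewrite BadE inE => /eqP ->; split=> //; rewrite hE; nia.
    have : (2 * phi C = h)%N by apply: good; rewrite inE CBad.
    by move: h0; nia.
exists m; split=> //.
(* A subgroup of [H] centralizing these representatives is central: [H] is abelian, and every
   element outside [H] is the product of an element of [H] and a representative. *)
pose s := [seq repr (C :&: invols) | C <- enum (P :\ (H : {set gT}))].
have tP C : C \in P :\ (H : {set gT}) -> repr (C :&: invols) \in C :&: invols.
  move=> /phim[+ _]; rewrite card_gt0 => /set0Pn[x]; exact: mem_repr.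
have defC C t : C \in P -> t \in C -> C = H :* t.
  by case/rcosetsP=> x _ -> tC; apply/esym/rcoset_eqP.
have [t|K [KH Ks hK]] := @cent_seq_card H s (2 * m).
  case/mapP => C; rewrite mem_enum => PC ->.
  have /setIP[Ct It] := tP _ PC; have [_] := phim _ PC.
  have PC' : C \in P by move: PC; rewrite inE => /andP[].
  by rewrite {1}/phi {1}(defC _ _ PC' Ct) rcoset_invols // card_rcoset.
have KZ : K \subset central_invols.
  rewrite subsetI (subset_trans KH HI) andbT subsetI subsetT /=.
  apply/centsP => x Kx y _; apply: commute_sym.
  have cH z : z \in H -> commute z x.
    by move=> Hz; apply: (centsP (sub_invols_abelian HI)) => //; apply: (subsetP KH).
  have PC : H :* y \in P by apply/rcosetsP; exists y.
  have [HE|HyH] := eqVneq (H :* y) (H : {set gT}).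
    by apply: cH; rewrite -HE rcoset_refl.
  have PC' : H :* y \in P :\ (H : {set gT}) by rewrite !inE HyH.
  have /setIP[Ct It] := tP _ PC'; set t := repr _ in Ct It.
  have : y \in H :* t by rewrite -(defC _ _ PC Ct) rcoset_refl.
  case/rcosetP=> z Hz ->; apply: commute_sym; apply: commuteM; apply: commute_sym.
    exact: cH.
  have : t \in 'C(K) by apply: Ks; apply/mapP; exists (H :* y); rewrite ?mem_enum.
  by move/centP; apply.
rewrite size_map -cardE in hK.
rewrite cardG -mulnA; apply: leq_mul => //; rewrite -/h.
apply: leq_trans hK _; apply: leq_mul; last exact: subset_leq_card.
by rewrite leq_pexp2l ?muln_gt0 ?m0 // ltnW.
Qed.

(* Squaring is constant on cosets of the central involutions. *)
Lemma card_squares : (#|[set x ^+ 2 | x in [set: gT]]| * #|central_invols| <= #|gT|)%N.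
Proof.
set Q := imset _ _; rewrite -[leqRHS]cardsT -[leqRHS]sum1_card.
rewrite (partition_big (fun x => x ^+ 2) (mem Q)) /=; last first.
  by move=> x _; apply: imset_f.
rewrite -sum_nat_const; apply: leq_sum => _ /imsetP[x _ ->].
rewrite sum1_card -(card_lcoset central_invols x); apply: subset_leq_card.
apply/subsetP => _ /lcosetP[e /setIP[/centerP[_ eC] Ie] ->].
rewrite unfold_in inE /= expgMn; last by apply/commute_sym/eC.
by move: Ie; rewrite inE => /eqP ->; rewrite mulg1.
Qed.

(** For a maximal such [X], every element of [E] lies in [Q] or in some [Q :* h^-1] with [h] in [X],
    so [#|X|.+1] translates of [Q] cover [E]. *)
Lemma greedy_avoiding (E Q : {set gT}) :
  1 \in Q -> E \subset invols -> {in E &, commutative mulg} ->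
  exists X : {set gT}, [/\ X \subset E, {in X, forall g, g \notin Q},
    {in X &, forall g h, g != h -> g * h \notin Q}
  & (#|E| <= #|X|.+1 * #|Q|)%N].
Proof.
move=> Q1 EI abE.
pose ok (X : {set gT}) := [&& X \subset E, [disjoint X & Q] &
  [forall g in X, forall h in X, (g != h) ==> (g * h \notin Q)]].
have ok0 : ok set0.
  apply/and3P; split; rewrite ?sub0set -?setI_eq0 ?set0I //.
  by apply/forall_inP => g; rewrite inE.
have [X /maxsetP[/and3P[XE XQ /forall_inP XX] maxX] _] := maxset_exists ok0.
exists X; split=> // [g gX|g h gX hX gh|].
- by rewrite (disjointFr XQ).
- by have /forall_inP/(_ _ hX)/implyP := XX _ gX; apply.
have sub : E \subset Q :|: \bigcup_(h in X) (Q :* h^-1).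
  apply/subsetP => e eE; rewrite inE; case: (boolP (e \in Q)) => //= eQ.
  apply: contraT => /bigcupP out.
  have outh h : h \in X -> e * h \notin Q.
    by move=> hX; apply/negP => ehQ; case: out; exists h; rewrite ?mem_rcoset ?invgK.
  have eX : e \notin X.
    apply/negP => /outh; have /involsP -> := subsetP EI _ eE.
    by rewrite Q1.
  case/negP: (eX); have /maxX/(_ (subsetUr _ _)) <- : ok (e |: X); last exact: setU11.
  apply/and3P; split.
  - by rewrite subUset sub1set eE.
  - by rewrite -setI_eq0 setIUl setU_eq0 !setI_eq0 XQ disjoints1 eQ.
  - apply/forall_inP => g /setU1P gP; apply/forall_inP => h /setU1P hP.
    apply/implyP; case: gP hP => [->|gX] [->|hX] gh.
    + by rewrite eqxx in gh.
    + exact: outh.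
    + by rewrite (abE _ _ (subsetP XE _ gX) eE) outh.
    + by have /forall_inP/(_ _ hX)/implyP := XX _ gX; apply.
apply: leq_trans (subset_leq_card sub) _; rewrite mulSn.
apply: leq_trans (leq_card_setU _ _) _; rewrite leq_add2l -sum_nat_const.
apply: (big_ind2 (fun (A : {set gT}) n => #|A| <= n)%N) => [|A1 n1 A2 n2 h1 h2|h _].
- by rewrite cards0.
- by apply: leq_trans (leq_card_setU _ _) _; apply: leq_add.
- by rewrite card_rcoset.
Qed.

End Involutions.

(** * The graph attached to a group element *)

Section Edges.
Variables (T : finType) (e : rel T).
Hypothesis symE : symmetric e.
Implicit Types x y : T.

Definition neighbours x := [set y | (y != x) && e x y].

(** Edges are two-element sets, as in [Pr_free_le]; loops are left out and are treated in
    [unreached] through square roots. *)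
Definition edge_set : {set {set T}} :=
  [set [set u.1; u.2] | u in [set u : T * T | (u.1 != u.2) && e u.1 u.2]].

Lemma edge_set_card2 : {in edge_set, forall f : {set T}, #|f| = 2}.
Proof. by move=> _ /imsetP[u + ->]; rewrite inE cards2 => /andP[->]. Qed.

Lemma set2_inj x : injective (fun y => [set x; y]).
Proof.
move=> y z eq_yz; have : y \in [set x; z] by rewrite -eq_yz set22.
have : z \in [set x; y] by rewrite eq_yz set22.
by rewrite !inE => /orP[] /eqP -> /orP[] /eqP.
Qed.

Lemma mem_edge_set x y : ([set x; y] \in edge_set) = (y \in neighbours x).
Proof.
apply/imsetP/idP => [[[a b] + eq_xy]|]; rewrite inE => /andP[/= xy exy]; last first.
  by exists (x, y); rewrite // inE /= eq_sym xy.
have : x \in [set a; b] by rewrite -eq_xy set21.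
rewrite /= in eq_xy; rewrite !inE => /orP[] /eqP xE; rewrite {x}xE in eq_xy *.
  by rewrite (set2_inj eq_xy) eq_sym xy.
have -> : y = a by apply: (@set2_inj b); rewrite eq_xy setUC.
by rewrite xy symE.
Qed.

Lemma edge_set_at x : [set f in edge_set | x \in f] = [set [set x; y] | y in neighbours x].
Proof.
apply/setP => f; rewrite inE; apply/andP/imsetP => [[Ef xf]|[y yx ->]]; last first.
  by rewrite mem_edge_set set21.
have /eqP/cards2P[a [b [ab fE]]] := edge_set_card2 Ef.
move: xf; rewrite fE !inE => /orP[] /eqP xE.
  by exists b; rewrite xE // -mem_edge_set -fE.
by exists a; [rewrite -mem_edge_set xE setUC -fE | rewrite xE setUC].
Qed.

Lemma card_edge_set_at x : #|[set f in edge_set | x \in f]| = #|neighbours x|.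
Proof. by rewrite edge_set_at card_imset //; apply: set2_inj. Qed.

Lemma handshake : (2 * #|edge_set| = \sum_x #|neighbours x|)%N.
Proof.
transitivity (\sum_(f in edge_set) \sum_(x in f) 1)%N.
  rewrite mulnC -sum_nat_const; apply: eq_bigr => f /edge_set_card2 f2.
  by rewrite sum1_card f2.
rewrite (exchange_big_dep predT) //=; apply: eq_bigr => x _.
by rewrite -card_edge_set_at -sum1_card; apply: eq_bigl => f; rewrite inE.
Qed.

End Edges.

(** * Group elements as products of two elements *)

Section ProductGraph.
Local Open Scope group_scope.
Variable gT : finGroupType.
Implicit Types (g h x y : gT) (S : {set gT}).

(* [adj g x y] holds when joining both [x] and [y] to the connection set makes
   [g] a product of two elements of its symmetrisation. *)
Definition adj g x y : bool :=
  g \in [:: x * y; x * y^-1; x^-1 * y; x^-1 * y^-1;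
            y * x; y * x^-1; y^-1 * x; y^-1 * x^-1].

Lemma adj_sym g : symmetric (adj g).
Proof. by move=> x y; rewrite /adj -[LHS](mem_rot 4). Qed.

(** Each of the eight equations is solved for [y], which shows the degree bound 8. *)
Lemma adjE g x y : adj g x y =
  (y \in [:: x^-1 * g; g^-1 * x; x * g; g^-1 * x^-1;
             g * x^-1; g * x; x * g^-1; x^-1 * g^-1]).
Proof.
rewrite /adj !inE; do ![congr (_ || _)]; apply/eqP/eqP => ->;
  by rewrite ?invMg ?invgK ?mulgA ?mulKg ?mulKVg ?mulgK ?mulgKV ?mulVg ?mulgV ?mul1g
             -?mulgA ?mulKg ?mulKVg ?mulgK ?mulgKV ?mulVg ?mulgV ?mulg1.
Qed.

Definition edges g := edge_set (adj g).

Lemma card_neighbours_le g x : #|neighbours (adj g) x| <= 8.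
Proof.
set s := [:: x^-1 * g; g^-1 * x; x * g; g^-1 * x^-1;
             g * x^-1; g * x; x * g^-1; x^-1 * g^-1].
apply: leq_trans (card_size s); apply: subset_leq_card; apply/subsetP => y.
by rewrite inE adjE => /andP[].
Qed.

Definition square_roots g := [set x : gT | x * x == g].

(** [x * g] is always a neighbour, and [x^-1 * g] is a second one unless it equals [x * g] (when [x]
    has square 1) or [x] (when [x] is a square root of [g]). *)
Lemma card_neighbours_ge g x : g != 1 ->
  2 <= #|neighbours (adj g) x| + (x \in invols gT) + 2 * (x \in square_roots g).
Proof.
move=> g1; have xg : x * g \in neighbours (adj g) x.
  by rewrite inE adjE !inE eqxx !orbT andbT -[X in _ != X]mulg1 (inj_eq (mulgI x)).
have deg1 : 0 < #|neighbours (adj g) x| by rewrite card_gt0; apply/set0Pn; exists (x * g).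
have [_|xg'] := boolP (x \in square_roots g); first lia.
have [_|xI] := boolP (x \in invols gT); first lia.
suff : #|[set x * g; x^-1 * g]| <= #|neighbours (adj g) x|.
  rewrite cards2 (inj_eq (mulIg g)); suff -> : x != x^-1 by lia.
  by apply: contra xI => /eqP xx; apply/involsP; rewrite {2}xx mulgV.
apply: subset_leq_card; rewrite subUset !sub1set xg inE adjE !inE eqxx andbT /=.
by apply: contra xg' => /eqP xx; rewrite inE -{2}xx mulKVg.
Qed.

Lemma card_edges_ge g : g != 1 ->
  2 * #|gT| <= 2 * #|edges g| + #|invols gT| + 2 * #|square_roots g|.
Proof.
move=> g1; rewrite handshake; last exact: adj_sym.
have cardE (A : {set gT}) : #|A| = \sum_x (x \in A).
  by rewrite -sum1_card big_mkcond; apply: eq_bigr => x _; case: (x \in A).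
rewrite (cardE (invols _)) (cardE (square_roots _)) big_distrr -!big_split /=.
rewrite -cardsT mulnC -sum_nat_const; under eq_bigl do rewrite inE.
by apply: leq_sum => x _; apply: card_neighbours_ge.
Qed.

Lemma central_involsP g : g \in central_invols gT ->
  g * g = 1 /\ forall x, x * g = g * x.
Proof.
move=> /setIP[/centerP[_ gC] /involsP gg]; split=> // x.
by rewrite gC ?inE.
Qed.

Lemma neighbours_central g x y : g \in central_invols gT ->
  adj g x y -> y = x * g \/ y = x^-1 * g.
Proof.
move=> gZ; have [_ gC] := central_involsP gZ.
have gV : g^-1 = g by apply: invols_inv; case/setIP: gZ.
by rewrite adjE gV -!gC !inE => H; do ![case/predU1P: H => [->|H]]; try move/eqP: H => ->;
  auto.
Qed.

(** The only possible neighbours [x * g] and [x^-1 * g] coincide when [x] has square 1. *)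
Lemma card_edges_le g : g \in central_invols gT ->
  2 * #|edges g| + #|invols gT| <= 2 * #|gT|.
Proof.
move=> gZ; rewrite handshake; last exact: adj_sym.
have cardE (A : {set gT}) : #|A| = \sum_x (x \in A).
  by rewrite -sum1_card big_mkcond; apply: eq_bigr => x _; case: (x \in A).
rewrite (cardE (invols _)) -!big_split /=.
rewrite -cardsT mulnC -sum_nat_const; under [leqRHS]eq_bigl do rewrite inE.
apply: leq_sum => x _.
have sub : neighbours (adj g) x \subset [set x * g; x^-1 * g].
  by apply/subsetP => y; rewrite !inE => /andP[_ /(neighbours_central gZ)[]->]; rewrite eqxx ?orbT.
have := subset_leq_card sub; rewrite cards2 (inj_eq (mulIg g)).
by have [/invols_inv ->|] := boolP (x \in invols gT); case: eqP => //=; lia.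
Qed.

(** A common edge gives two expressions for one endpoint in terms of the other, [x]. Equating them
    yields [g = h], or [x * g = x^-1 * h] up to inverting [x], and then [g * h] is a square. *)
Lemma disjoint_edges g h : g \in central_invols gT -> h \in central_invols gT ->
  g != h -> g * h \notin [set x ^+ 2 | x in [set: gT]] ->
  [disjoint edges g & edges h].
Proof.
move=> gZ hZ gh nsq; rewrite -setI_eq0; apply/eqP/setP => f; rewrite !inE.
apply/negP => /andP[fg fh]; have /eqP/cards2P[x [y [xy fE]]] := edge_set_card2 fg.
have [gg gC] := central_involsP gZ; have [hh hC] := central_involsP hZ.
have nsq' x' : x' * g = x'^-1 * h -> False.
  move=> eq_x; case/negP: nsq; apply/imsetP; exists x'^-1; rewrite // expgS expg1.
  have xV : x'^-1 = x' * g * h by rewrite eq_x -mulgA hh mulg1.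
  by rewrite {2}xV -mulgA mulKg.
move: fg fh; rewrite fE !mem_edge_set ?inE; try exact: adj_sym.
move=> /andP[_ /(neighbours_central gZ) yg] /andP[_ /(neighbours_central hZ) yh].
case: yg yh => -> [].
- by move/mulgI/eqP; rewrite (negPf gh).
- exact: nsq'.
- by rewrite -{2}[x]invgK; apply: nsq'.
- by move/mulgI/eqP; rewrite (negPf gh).
Qed.

Definition symm S x := (x \in S) || (x^-1 \in S).

(* The vertex [g] is at distance more than 2 from [1]. *)
Definition unreached g S :=
  [&& g != 1, ~~ symm S g, free (edges g) S & [disjoint square_roots g & S]
    && [disjoint square_roots g^-1 & S]].

(** Edges of [adj g] account for products of two different elements of [S] up to inversion, square
    roots of [g] and [g^-1] for one element used twice. *)
Lemma unreachedP g S : reflect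
  [/\ g <> 1, ~~ symm S g & forall a b, symm S a -> symm S b -> g <> b * a] (unreached g S).
Proof.
have adjP a b : symm S a -> symm S b -> g = b * a ->
    exists x y, [/\ x \in S, y \in S & adj g x y].
  move=> /orP[] aS /orP[] bS ->.
  - by exists a, b; rewrite /adj !inE eqxx !orbT.
  - by exists a, b^-1; rewrite /adj !inE invgK eqxx !orbT.
  - by exists a^-1, b; rewrite /adj !inE invgK eqxx !orbT.
  - by exists a^-1, b^-1; rewrite /adj !inE !invgK eqxx !orbT.
(* On the diagonal, [x * x^-1] is excluded by [g != 1], which leaves the squares of [x] and
   [x^-1]. *)
have rootP x : x \in S -> adj g x x -> g != 1 -> (x * x == g) || (x * x == g^-1).
  move=> xS + g1; rewrite /adj !inE !mulgV !mulVg (negPf g1) /= => H.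
  by do ![case/orP: H => H]; move/eqP: H => ->; rewrite ?invMg ?invgK eqxx ?orbT.
apply: (iffP and4P) => [[g1 gS fr /andP[d1 d2]]|[g1 gS nab]].
  split=> // [|a b aS bS gE]; first exact/eqP.
  have [x [y [xS yS xy]]] := adjP _ _ aS bS gE.
  have [yx|yx] := eqVneq y x.
    rewrite {}yx in xy; have /orP[] := rootP _ xS xy g1 => xg.
      by have := disjointFl d1 xS; rewrite inE xg.
    by have := disjointFl d2 xS; rewrite inE xg.
  have := forall_inP fr [set x; y]; rewrite mem_edge_set; last exact: adj_sym.
  by rewrite inE yx xy subUset !sub1set xS yS => /(_ isT).
split=> //; first exact/eqP.
  apply/forall_inP => f fg; apply/negP => fS.
  have /eqP/cards2P[x [y [xy fE]]] := edge_set_card2 fg.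
  move: fg fS; rewrite fE mem_edge_set; last exact: adj_sym.
  rewrite subUset !sub1set inE /adj => /andP[_ gxy] /andP[xS yS].
  have sx : symm S x by rewrite /symm xS.
  have sy : symm S y by rewrite /symm yS.
  have sx' : symm S x^-1 by rewrite /symm invgK xS orbT.
  have sy' : symm S y^-1 by rewrite /symm invgK yS orbT.
  rewrite !inE in gxy.
  by do ![case/orP: gxy => gxy]; move/eqP: gxy; apply: nab.
rewrite -!setI_eq0; apply/andP; split; apply/eqP/setP => x; rewrite !inE;
  apply/negP => /andP[/eqP xx xS].
  by apply: (nab x x); rewrite /symm ?xS.
by apply: (nab x^-1 x^-1); rewrite /symm ?invgK ?xS ?orbT // -invMg xx invgK.
Qed.

Lemma unreached_decreasing g : decreasing (unreached g).
Proof.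
move=> S1 S2 S12 /unreachedP[g1 gS nab].
have symS x : symm S1 x -> symm S2 x.
  by case/orP => /(subsetP S12) xS; rewrite /symm xS ?orbT.
apply/unreachedP; split=> // [|a b /symS aS /symS]; last exact: nab.
exact: contra (symS g) gS.
Qed.

(** Right translations are automorphisms of the Cayley graph, so distances from the identity
    suffice; see [diameter_le2]. *)
Definition far S := [exists g, unreached g S].

Lemma far_decreasing : decreasing far.
Proof.
move=> S1 S2 S12 /existsP[g gS]; apply/existsP; exists g.
exact: unreached_decreasing gS.
Qed.

(** A non-square differs from 1 and has no square roots, and [g^-1 = g], so only two conditions
    remain. *)
Lemma unreached_central g S : g \in central_invols gT ->
  g \notin [set x ^+ 2 | x in [set: gT]] ->
  (g \notin S) && free (edges g) S -> unreached g S.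
Proof.
move=> gZ nsq /andP[gS fr]; have gV : g^-1 = g by apply: invols_inv; case/setIP: gZ.
have noroot : square_roots g = set0.
  apply/setP => x; rewrite !inE; apply/negP => /eqP xx.
  by case/negP: nsq; apply/imsetP; exists x; rewrite // expgS expg1.
apply/and4P; split=> //; last by rewrite gV noroot -setI_eq0 set0I eqxx.
  by apply: contra nsq => /eqP ->; apply/imsetP; exists 1; rewrite ?expg1n.
by rewrite /symm gV (negPf gS).
Qed.

End ProductGraph.

(** * Quantitative bounds *)

Section Bounds.
Local Open Scope ring_scope.
Variable R : realType.
Implicit Types (p c e eta : R) (gT : finGroupType).

Definition inv_ratio gT : R := #|invols gT|%:R / #|gT|%:R.

(** [kappa gT * #|gT|] bounds [#|edges g|] from below for [g != 1], up to the number of square roots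
    of [g], and from above for [g] in [central_invols]. The threshold is decided by comparing
    [c * kappa gT] with 1. *)
Definition kappa gT : R := 1 - inv_ratio gT / 2.

Lemma card_group_gt0 gT : 0 < #|gT|%:R :> R.
Proof. by rewrite ltr0n -cardsT cardG_gt0. Qed.

Lemma inv_ratio01 gT : 0 <= inv_ratio gT <= 1.
Proof.
rewrite divr_ge0 ?ler0n //= ler_pdivrMr ?card_group_gt0 // mul1r ler_nat.
exact: max_card.
Qed.

Lemma exp_le_expR (a : R) k : a <= 1 -> (1 - a) ^+ k <= expR (- (a * k%:R)).
Proof.
move=> a1; rewrite -mulNr expRM_natr lerXn2r ?nnegrE ?subr_ge0 ?expR_ge0 //.
exact: expR_ge1Dx.
Qed.

(** For these [a], [1 / (1 - a) <= 1 + a + 2 * a ^ 2 <= expR (a + 2 * a ^ 2)]. *)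
Lemma exp_ge_expR (a : R) k : 0 <= a -> a <= 1 / 2 ->
  expR (- ((a + 2 * a ^+ 2) * k%:R)) <= (1 - a) ^+ k.
Proof.
move=> a0 a2; rewrite -mulNr expRM_natr lerXn2r ?nnegrE ?subr_ge0 ?expR_ge0 //; first lra.
rewrite expRN -[leRHS]invrK lef_pV2 ?posrE ?expR_gt0 ?invr_gt0 //; last lra.
apply: le_trans (expR_ge1Dx _); have a1 : 0 < 1 - a by lra.
by rewrite -[leLHS]mul1r ler_pdivrMr //; nra.
Qed.

(** If [g] has at least [p * n] square roots, avoiding them is already unlikely enough. Otherwise
    they cost at most [p * n] edges and the degree bound 8 costs a factor [1 - 16 * p], together at
    most [17 * p]. *)
Lemma Pr_unreached_le gT p (g : gT) : 0 <= p -> 16 * p <= 1 -> g != 1%g ->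
  Pr (fun=> p) (unreached g) <= expR (- (p ^+ 2 * #|gT|%:R * (kappa gT - 17 * p))).
Proof.
move=> p0 p16 g1; have p01 : 0 <= p <= 1 by lra.
have n0 := card_group_gt0 gT; set n : R := #|gT|%:R in n0 *.
have /andP[i0 i1] := inv_ratio01 gT.
have [big|small] := leP (p * n) #|square_roots g|%:R.
  apply: (@le_trans _ _ (Pr (fun=> p) (fun S => [disjoint square_roots g & S]))).
    by apply: le_Pr => // S /and4P[_ _ _ /andP[]].
  rewrite Pr_disjoint; apply: le_trans (exp_le_expR _ _) _; first lra.
  rewrite ler_expR lerN2 expr2 -!mulrA; apply: ler_wpM2l => //.
  apply: le_trans big; apply: ler_wpM2l => //.
  by rewrite -[leRHS]mulr1; apply: ler_wpM2l; rewrite ?(ltW n0) // /kappa; lra.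
apply: (@le_trans _ _ (Pr (fun=> p) (free (edges g)))).
  by apply: le_Pr => // S /and4P[].
apply: le_trans (@Pr_free_le _ _ _ p01 8 _ _ _ _) _.
- exact: edge_set_card2.
- by move=> x; rewrite card_edge_set_at ?card_neighbours_le //; apply: adj_sym.
- exact: p16.
rewrite (_ : 8.*2%:R = 16) //; apply: le_trans (exp_le_expR _ _) _; first nra.
rewrite ler_expR lerN2 -[leLHS]mulrA -[leRHS]mulrA; apply: ler_wpM2l; first exact: exprn_ge0.
have := card_edges_ge g1; rewrite -(ler_nat R) !(natrM, natrD) -/n.
set f : R := #|edges g|%:R; set r : R := #|square_roots g|%:R in small *.
have -> : #|invols gT|%:R = inv_ratio gT * n by rewrite /inv_ratio divfK // gt_eqF.
move: small i0 i1; rewrite /kappa; move: (inv_ratio gT) => i small i0 i1 fge.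
have f0 : 0 <= f by rewrite ler0n.
have fge' : n * (1 - i / 2 - p) <= f by lra.
have h : (1 - 16 * p) * (n * (1 - i / 2 - p)) <= (1 - 16 * p) * f.
  by apply: ler_wpM2l => //; lra.
apply: le_trans h.
have : 0 <= n * (p * (i / 2 + p)).
  by apply: mulr_ge0; [exact: ltW|apply: mulr_ge0 => //; lra].
lra.
Qed.

Lemma Pr_far_le gT p : 0 <= p -> 16 * p <= 1 ->
  Pr (fun=> p) (@far gT) <= #|gT|%:R * expR (- (p ^+ 2 * #|gT|%:R * (kappa gT - 17 * p))).
Proof.
move=> p0 p16; have p01 (x : gT) : 0 <= (fun=> p) x <= 1 by lra.
apply: (@le_trans _ _ (Pr (fun=> p) (fun S => [exists g : gT, predT g && unreached g S]))).
  exact: le_Pr.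
apply: le_trans (Pr_exists _ _ p01) _; rewrite mulr_natl -sumr_const.
apply: ler_sum => g _; have [->|g1] := eqVneq g 1%g; last exact: Pr_unreached_le.
suff -> : Pr (fun=> p) (unreached (1%g : gT)) = 0 by apply: expR_ge0.
rewrite -[RHS](@Ex_cst _ gT (fun=> p)); apply: eq_Ex => S.
by rewrite /unreached eqxx.
Qed.

(** * The critical probability and the first moment bound *)

Definition critical_prob c gT : R := Num.sqrt (c * (ln #|gT|%:R / #|gT|%:R)).

Lemma critical_prob_sqr c gT : 0 < c -> 0 <= ln (#|gT|%:R : R) ->
  critical_prob c gT ^+ 2 * #|gT|%:R = c * ln #|gT|%:R.
Proof.
move=> c0 L0; rewrite sqr_sqrtr; last first.
  by rewrite mulr_ge0 ?divr_ge0 ?ler0n // ltW.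
by rewrite -mulrA divfK // gt_eqF ?card_group_gt0.
Qed.

(** For the critical probability [q], [q * (c * ln n)] is [q ^ 3 * n], the size of the error terms
    in the exponents. It tends to 0, like [q], because [n] is at least [(ln n) ^ 4 / 24]. *)
Lemma critical_prob_small c e : 0 < c -> 0 < e ->
  exists A : R, forall gT, A <= ln (#|gT|%:R : R) ->
    [/\ 0 <= ln (#|gT|%:R : R), critical_prob c gT <= e
      & critical_prob c gT * (c * ln #|gT|%:R) <= e].
Proof.
(* This makes [24 * (c + c ^ 3) <= e ^ 2 * L], which serves both bounds once squared, through [key]
   with [d = c] and [d = c ^ 3]. *)
move=> c0 e0; exists (1 + 24 * (c + c ^+ 3) / e ^+ 2) => gT.
have n0 := card_group_gt0 gT; set n : R := #|gT|%:R in n0 *; set L := ln n => AL.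
have e20 : 0 < e ^+ 2 by rewrite exprn_gt0.
have c30 : 0 < c ^+ 3 by rewrite exprn_gt0.
have L1 : 1 <= L.
  apply: le_trans AL; rewrite lerDl divr_ge0 ?ltW //; nra.
have L0 : 0 < L by lra.
have nL : L ^+ 4 / 24 <= n.
  have := @expR_ge1Dxn R L 3 (ltW L0); rewrite /L lnK ?posrE // -/L.
  rewrite (_ : 4`! = 24%N) //; lra.
have bnd : 24 * (c + c ^+ 3) <= e ^+ 2 * L.
  rewrite [leRHS]mulrC -ler_pdivrMr //; lra.
have psq := critical_prob_sqr c0 (ltW L0); rewrite -/n -/L in psq.
have p0 : 0 <= critical_prob c gT by apply: sqrtr_ge0.
have L3n : L ^+ 3 * L <= 24 * n by rewrite -exprSr; lra.
have L30 : 0 < L ^+ 3 by rewrite exprn_gt0.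
have key (d : R) : 0 < d -> 24 * d <= e ^+ 2 * L -> d * L ^+ 3 <= e ^+ 2 * n.
  move=> d0 dL; rewrite -(ler_pM2r L0).
  have : d * (L ^+ 3 * L) <= d * (24 * n) by apply: ler_wpM2l => //; apply: ltW.
  have : 24 * d * n <= e ^+ 2 * L * n by apply: ler_wpM2r => //; apply: ltW.
  lra.
split; first exact: ltW.
- rewrite -ler_sqr ?nnegrE ?(ltW e0) // -(ler_pM2r n0) psq.
  apply: le_trans (key c c0 _); last by lra.
  apply: ler_wpM2l; first exact: ltW.
  by apply: ler_eXnr.
- rewrite -ler_sqr ?nnegrE ?(ltW e0) ?mulr_ge0 ?(ltW c0) ?(ltW L0) //.
  rewrite exprMn -(ler_pM2r n0) mulrAC psq.
  have -> : c * L * (c * L) ^+ 2 = c ^+ 3 * L ^+ 3 by ring.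
  by apply: key => //; lra.
Qed.

(** At the critical probability [q] the first moment is at most [expR (L * (1 - c * kappa gT + 17 *
    c * q))], hence at most [expR (- L * eta / 2)] once [34 * c * q <= eta]. The constant [A] is the
    same for all groups. *)
Lemma far_unlikely c eta e : 0 < c -> 0 < eta -> 0 < e ->
  exists A : R, forall gT p, A <= ln (#|gT|%:R : R) -> 0 <= p <= 1 ->
    critical_prob c gT <= p -> 1 + eta <= c * kappa gT ->
    Pr (fun=> p) (@far gT) <= e.
Proof.
move=> c0 eta0 e0.
have d0 : 0 < Num.min (1 / 16) (eta / (34 * c)).
  by rewrite lt_min !divr_gt0 // mulr_gt0.
have [A0 A0P] := critical_prob_small c0 d0.
exists (Num.max A0 (- ln e * 2 / eta)) => gT p; rewrite ge_max => /andP[/A0P[L0 q1 _] AL].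
move=> p01 qp kap; set q := critical_prob c gT in q1 qp.
have q0 : 0 <= q by apply: sqrtr_ge0.
move: q1; rewrite le_min => /andP[q16 qc].
have /andP[p0 p1] := p01.
(* [far] is decreasing, so [p] may be lowered to [q]. *)
apply: (@le_trans _ _ (Pr (fun=> q) (@far gT))).
  apply: Pr_decreasing_weight => // [x|]; last exact: far_decreasing.
  by rewrite q0 (le_trans qp).
have q16' : 16 * q <= 1 by lra.
apply: le_trans (@Pr_far_le gT q q0 q16') _.
rewrite critical_prob_sqr //; set L := ln _ in L0 AL *.
rewrite -{1}(@lnK _ #|gT|%:R) ?posrE ?card_group_gt0 // -expRD -/L.
rewrite -[leRHS](@lnK _ e) ?posrE // ler_expR.
have : c * (34 * q) <= eta.
  by move: qc; rewrite ler_pdivlMr ?mulr_gt0 //; lra.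
move=> qc'; have h : L * (1 + eta) <= L * (c * kappa gT) by apply: ler_wpM2l.
have h2 : L * (c * (34 * q)) <= L * eta by apply: ler_wpM2l.
move: AL; rewrite ler_pdivrMr // => AL.
lra.
Qed.


(** * The second moment over central involutions *)

Lemma Pr_central_ge gT p (g : gT) : 0 <= p <= 1 / 2 -> g \in central_invols gT ->
  expR (- (4 * p + (p ^+ 2 + 2 * p ^+ 3) * #|edges g|%:R))
    <= Pr (fun=> p) (fun S => (g \notin S) && free (edges g) S).
Proof.
move=> /andP[p0 p2] gZ; have p01 : 0 <= p <= 1 by lra.
apply: (@le_trans _ _ ((1 - p) * Pr (fun=> p) (free (edges g)))); last first.
  by apply: Pr_notin_ge => //; apply/decreasingW/free_decreasing.
rewrite opprD expRD; apply: ler_pM; rewrite ?expR_ge0 //.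
  have := @exp_ge_expR p 1 p0 p2; rewrite expr1; apply: le_trans.
  rewrite ler_expR; nra.
apply: le_trans (Pr_free_ge _ _) => //; last exact: edge_set_card2.
apply: le_trans (exp_ge_expR _ _ _); first last.
- nra.
- exact: sqr_ge0.
rewrite ler_expR lerN2; apply: ler_wpM2r; first exact: ler0n.
rewrite lerD2l; apply: ler_wpM2l => //; rewrite -exprM.
by rewrite (_ : (2 * 2)%N = 4%N) // exprSr ler_piMr ?exprn_ge0 //; lra.
Qed.

(** The union of the two graphs has degree at most 16, whence [32 * p], and being edge-disjoint
    their edge numbers add up. *)
Lemma Pr_central_pair_le gT p (g h : gT) : 0 <= p -> 32 * p <= 1 ->
  [disjoint edges g & edges h] ->
  Pr (fun=> p) (fun S => ((g \notin S) && free (edges g) S)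
                        && ((h \notin S) && free (edges h) S))
    <= expR (- (p ^+ 2 * (1 - 32 * p) * (#|edges g|%:R + #|edges h|%:R))).
Proof.
move=> p0 p32 dgh; have p01 : 0 <= p <= 1 by lra.
apply: (@le_trans _ _ (Pr (fun=> p) (free (edges g :|: edges h)))).
  apply: le_Pr => // S /andP[/andP[_ /forall_inP frg] /andP[_ /forall_inP frh]].
  by apply/forall_inP => f; rewrite inE => /orP[/frg|/frh].
apply: le_trans (@Pr_free_le _ _ _ p01 16 _ _ _ _) _.
- by move=> f /setUP[] /edge_set_card2.
- move=> x; have -> : [set f in edges g :|: edges h | x \in f] =
      [set f in edges g | x \in f] :|: [set f in edges h | x \in f].
    by apply/setP => f; rewrite !inE andb_orl.
  apply: leq_trans (leq_card_setU _ _) _.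
  rewrite !card_edge_set_at; try exact: adj_sym.
  exact: leq_add (card_neighbours_le _ _) (card_neighbours_le _ _).
- exact: p32.
rewrite (_ : 16.*2%:R = 32) //; apply: le_trans (exp_le_expR _ _) _; first nra.
by rewrite cardsU (disjoint_setI0 dgh) cards0 subn0 natrD.
Qed.

Lemma card_edges_kappa gT (g : gT) : g \in central_invols gT ->
  #|edges g|%:R <= kappa gT * #|gT|%:R.
Proof.
move=> /card_edges_le; rewrite -(ler_nat R) !(natrM, natrD).
have n0 := card_group_gt0 gT.
have -> : #|invols gT|%:R = inv_ratio gT * #|gT|%:R by rewrite /inv_ratio divfK // gt_eqF.
rewrite /kappa; lra.
Qed.

(** By [card_squares] there are at most [B] squares, so the greedy set avoiding them has size of
    order [n / B ^ 2]. *)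
Lemma spread_central_invols gT (B : nat) : (#|gT| <= B * #|central_invols gT|)%N ->
  exists X : {set gT}, [/\ X \subset central_invols gT,
    {in X, forall g, g \notin [set x ^+ 2 | x in [set: gT]]%g},
    {in X &, forall g h, g != h -> [disjoint edges g & edges h]}
  & (#|gT| <= #|X|.+1 * B ^ 2)%N].
Proof.
move=> le_n; set Q := [set x ^+ 2 | x in [set: gT]]%g.
have [||x y xZ yZ|X [XE XQ XX cX]] := @greedy_avoiding _ (central_invols gT) Q.
- by apply/imsetP; exists 1%g; rewrite ?expg1n.
- exact: subsetIr.
- by have [_ ->] := central_involsP yZ.
exists X; split=> // [g h gX hX gh|].
  exact: disjoint_edges (subsetP XE _ gX) (subsetP XE _ hX) gh (XX _ _ gX hX gh).
have Z0 : (0 < #|central_invols gT|)%N.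
  by rewrite card_gt0; apply/set0Pn; exists 1%g; rewrite !inE !group1 expg1n eqxx.
have QB : (#|Q| <= B)%N.
  by rewrite -(leq_pmul2r Z0); apply: leq_trans (card_squares _) le_n.
apply: leq_trans le_n _; rewrite expnS expn1 mulnCA leq_mul2l.
by rewrite (leq_trans cX) ?orbT // leq_mul2l QB orbT.
Qed.

(** Second moment method over the edge-disjoint family [X]: the expected number of events is at
    least of order [n ^ eta]. *)
Lemma far_likely c eta e (B : nat) : 0 < c -> 0 < eta -> 0 < e ->
  exists A : R, forall gT p, A <= ln (#|gT|%:R : R) -> 0 <= p <= 1 ->
    p <= critical_prob c gT -> c * kappa gT <= 1 - eta ->
    (#|gT| <= B * #|central_invols gT|)%N ->
    1 - e <= Pr (fun=> p) (@far gT).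
Proof.
move=> c0 eta0 e0; have e2 : 1 < 1 + e / 2 by rewrite ltrDl divr_gt0.
(* With [f] and [f'] edges, the exponents for a pair and for two single events differ by at most
   [8 * p + 34 * p ^ 3 * (f + f') <= 80 * d]; hence the choice gives [rho <= 1 + e / 2]. *)
pose d := Num.min (1 / 32) (ln (1 + e / 2) / 80).
have d0 : 0 < d by rewrite lt_min !divr_gt0 // ln_gt0.
have [A0 A0P] := critical_prob_small c0 d0.
(* The second bound gives [n <= 2 * B ^ 2 * #|X|], and the third makes the expected number at least
   [2 / e]. *)
exists (Num.max A0 (Num.max (ln (2 * B%:R ^+ 2)) ((ln (4 * B%:R ^+ 2 / e) + 1) / eta))).
move=> gT p; rewrite !ge_max => /and3P[/A0P[L0 q1 q2] AL1 AL2].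
move=> /andP[p0 p1] pq kap le_n; set q := critical_prob c gT in q1 q2 pq.
have p01 : 0 <= p <= 1 by rewrite p0.
have n0 := card_group_gt0 gT; set n : R := #|gT|%:R in n0 L0 AL1 AL2 q2 *.
set L := ln n in L0 AL1 AL2 q2 *.
have nE : n = expR L by rewrite lnK.
have B0 : (0 < B)%N.
  by case: B le_n {AL1 AL2} => //; rewrite mul0n leqNgt -cardsT cardG_gt0.
have B0' : 0 < B%:R ^+ 2 :> R by rewrite exprn_gt0 // ltr0n.
have [X [XZ Xsq Xdis cX]] := spread_central_invols le_n.
have p2n : p ^+ 2 * n <= c * L.
  rewrite -critical_prob_sqr //; apply: ler_wpM2r; first exact: ltW.
  by rewrite lerXn2r ?nnegrE // (le_trans p0).
have pd : p <= d by apply: le_trans q1.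
have p3n : p ^+ 3 * n <= d.
  apply: le_trans q2; rewrite exprS -mulrA; apply: ler_pM => //.
  by rewrite mulr_ge0 ?exprn_ge0 // ltW.
have p3n0 : 0 <= p ^+ 3 * n by rewrite mulr_ge0 ?exprn_ge0 // ltW.
have d32 : d <= 1 / 32 by rewrite /d ge_min lexx.
have dln : 80 * d <= ln (1 + e / 2).
  rewrite mulrC -ler_pdivlMr //; by rewrite /d ge_min lexx orbT.
have kap0 : 0 <= kappa gT <= 1 by have := inv_ratio01 gT; rewrite /kappa; lra.
pose D (g : gT) (S : {set gT}) := (g \notin S) && free (edges g) S.
pose rho := expR (80 * d).
have rho1 : 1 <= rho by rewrite -expR0 ler_expR; lra.
have fle g : g \in X -> (0 : R) <= #|edges g|%:R <= kappa gT * n.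
  by move=> gX; rewrite ler0n card_edges_kappa // (subsetP XZ).
have Dge g : g \in X -> expR (- (1 + (1 - eta) * L)) <= Pr (fun=> p) (D g).
  move=> gX; have /andP[f0 f1] := fle g gX.
  apply: le_trans (Pr_central_ge _ (subsetP XZ _ gX)); last lra.
  rewrite ler_expR lerN2.
  have : (p ^+ 2 + 2 * p ^+ 3) * #|edges g|%:R <= (p ^+ 2 + 2 * p ^+ 3) * (kappa gT * n).
    by apply: ler_wpM2l => //; rewrite addr_ge0 ?mulr_ge0 ?exprn_ge0.
  have : kappa gT * (p ^+ 2 * n) <= kappa gT * (c * L).
    by apply: ler_wpM2l => //; case/andP: kap0.
  have : c * kappa gT * L <= (1 - eta) * L by apply: ler_wpM2r.
  have : kappa gT * (p ^+ 3 * n) <= 1 * (p ^+ 3 * n).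
    by apply: ler_wpM2r => //; case/andP: kap0.
  lra.
have pairs : {in X &, forall g h, g != h ->
    Pr (fun=> p) (fun S => D g S && D h S)
      <= rho * (Pr (fun=> p) (D g) * Pr (fun=> p) (D h))}.
  move=> g h gX hX gh; have /andP[f0 f1] := fle g gX; have /andP[f0' f1'] := fle h hX.
  apply: le_trans (Pr_central_pair_le p0 _ (Xdis _ _ gX hX gh)) _; first lra.
  have p12 : 0 <= p <= 1 / 2 by lra.
  have := Pr_central_ge p12 (subsetP XZ _ gX); have := Pr_central_ge p12 (subsetP XZ _ hX).
  rewrite -/(D g) -/(D h) => hh hg.
  apply: (@le_trans _ _ (rho *
    (expR (- (4 * p + (p ^+ 2 + 2 * p ^+ 3) * #|edges g|%:R)) *
     expR (- (4 * p + (p ^+ 2 + 2 * p ^+ 3) * #|edges h|%:R))))); last first.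
    by apply: ler_wpM2l; rewrite ?expR_ge0 //; apply: ler_pM; rewrite ?expR_ge0.
  rewrite -!expRD ler_expR.
  have := ler_wpM2l (exprn_ge0 3 p0) f1; have := ler_wpM2l (exprn_ge0 3 p0) f1'.
  have : kappa gT * (p ^+ 3 * n) <= 1 * (p ^+ 3 * n).
    by apply: ler_wpM2r => //; case/andP: kap0.
  lra.
have sumD : e / 2 * \sum_(g in X) Pr (fun=> p) (D g) >= 1.
  apply: (@le_trans _ _ (e / 2 * (#|X|%:R * expR (- (1 + (1 - eta) * L))))); last first.
    rewrite ler_pM2l ?divr_gt0 // mulr_natl -sumr_const; exact: ler_sum.
  have nX : n <= 2 * B%:R ^+ 2 * #|X|%:R.
    move: cX; rewrite -(ler_nat R) natrM natrX -natr1 -/n.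
    have : 2 * B%:R ^+ 2 <= n.
      by move: AL1; rewrite -ler_expR -nE lnK // posrE mulr_gt0.
    lra.
  have h1 : 4 * B%:R ^+ 2 / e <= expR (eta * L - 1).
    have x0 : 0 < 4 * B%:R ^+ 2 / e by rewrite divr_gt0 // mulr_gt0 // ltr0n.
    have : ln (4 * B%:R ^+ 2 / e) <= eta * L - 1.
      by move: AL2; rewrite ler_pdivrMr //; lra.
    by rewrite -ler_expR lnK.
  have : n * expR (- (1 + (1 - eta) * L)) = expR (eta * L - 1).
    by rewrite nE -expRD; congr expR; lra.
  have E0 := expR_gt0 (- (1 + (1 - eta) * L)).
  move: (expR (- (1 + (1 - eta) * L))) (expR (eta * L - 1)) E0 h1 => x y x0 h1 nx.
  have : n * x <= 2 * B%:R ^+ 2 * #|X|%:R * x by apply: ler_wpM2r => //; apply: ltW.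
  move: h1; rewrite nx ler_pdivrMr // => h1 h2.
  rewrite -(ler_pM2l B0').
  have : y * e <= 2 * B%:R ^+ 2 * #|X|%:R * x * e by apply: ler_wpM2r => //; apply: ltW.
  lra.
have sum0 : 0 < \sum_(g in X) Pr (fun=> p) (D g).
  by rewrite -(pmulr_rgt0 (x := e / 2)) ?divr_gt0 // (lt_le_trans _ sumD).
have sm := second_moment (w := fun=> p) (fun=> p01) rho1 pairs sum0.
have : Pr (fun=> p) (fun S : {set gT} => ~~ far S) <= e.
  apply: (@le_trans _ _ (Pr (fun=> p) (fun S => ~~ [exists g in X, D g S]))).
    apply: le_Pr => // S; apply: contra => /exists_inP[g gX Dg].
    by apply/existsP; exists g; apply: unreached_central; rewrite ?(subsetP XZ) ?Xsq.
  apply: le_trans sm _.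
  have : rho <= 1 + e / 2.
    by rewrite -[leRHS]lnK ?ler_expR // posrE; lra.
  have : (\sum_(g in X) Pr (fun=> p) (D g))^-1 <= e / 2.
    by rewrite -[leLHS]mul1r ler_pdivrMr.
  lra.
rewrite PrC; lra.
Qed.

End Bounds.

(** * Diameter, and the dihedral family *)

Section Diameter.
Local Open Scope ring_scope.
Variable R : realType.

(** Lengths are integers, so an infimum below [k.+1] is witnessed by a path of length at most
    [k]. *)
Lemma graph_dist_le_nat (T : finType) (e : rel T) x y (k : nat) :
  (graph_dist R e x y <= k%:R%:E)%E <->
  exists s, [/\ path e x s, last x s = y & (size s <= k)%N].
Proof.
split=> [le_k|[s [xs sy sk]]]; last first.
  apply: (@le_trans _ _ (size s)%:R%:E); last by rewrite lee_fin ler_nat.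
  by apply: ereal_inf_lbound; exists s.
have : (graph_dist R e x y < k.+1%:R%:E)%E.
  by apply: le_lt_trans le_k _; rewrite lte_fin ltr_nat.
move=> /ereal_inf_lt[_ [s [xs sy] <-]]; rewrite lte_fin ltr_nat ltnS => sk.
by exists s.
Qed.

Lemma diameter_le2 (gT : finGroupType) (S : {set gT}) :
  (diameter R (cayley_graph S) <= 2%:R%:E)%E = ~~ far S.
Proof.
apply/idP/idP => [diam|/existsPn near].
  apply/existsPn => g; apply/negP => /unreachedP[g1 gS nab].
  have : (graph_dist R (cayley_graph S) 1%g g <= 2%:R%:E)%E.
    by apply: le_trans diam; apply: ereal_sup_ubound; exists (1%g, g).
  have symE u v : cayley_graph S u v -> symm S (v * u^-1)%g.
    by case/andP => _; rewrite /symm invMg invgK.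
  move=> /graph_dist_le_nat[[|a [|b [|? ?]]]] [] //=.
  - by move=> _ /esym.
  - by rewrite andbT => /symE + ag _; rewrite ag invg1 mulg1 (negPf gS).
  - move=> /and3P[/symE ea /symE eb _] bg _; rewrite invg1 mulg1 bg in ea eb.
    by apply: (nab _ _ ea eb); rewrite mulgKV.
apply: ge_ereal_sup => _ [[u v] _ <-] /=; apply/graph_dist_le_nat.
have edge a w : symm S a -> a != 1%g -> cayley_graph S w (a * w)%g.
  move=> aS a1; rewrite /cayley_graph /= mulgK invMg mulKVg; apply/andP; split=> //.
  by apply: contra a1 => /eqP wE; rewrite -(inj_eq (mulIg w)) mul1g -wE.
have [uv|uv] := eqVneq u v; first by exists [::].
have v_uv : v = (v * u^-1 * u)%g by rewrite mulgKV.
have uv1 : (v * u^-1)%g != 1%g.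
  by apply: contra uv => /eqP uv1; rewrite v_uv uv1 mul1g.
have [uvS|uvS] := boolP (symm S (v * u^-1)%g).
  by exists [:: v]; split=> //=; rewrite andbT v_uv edge // -v_uv.
have : exists a b, [/\ symm S a, symm S b & (v * u^-1 = b * a)%g].
  apply: contrapT => nab; have /unreachedP := near (v * u^-1)%g; case.
  by split=> // [|a b aS bS ab]; [exact/eqP | apply: nab; exists a, b].
move=> [a [b [aS bS ab]]].
(* Cayley graphs have no loops; a factor 1 would put [v * u^-1] itself in the symmetrised set. *)
have a1 : a != 1%g by apply: contraNneq uvS => a1; rewrite ab a1 mulg1.
have b1 : b != 1%g by apply: contraNneq uvS => b1; rewrite ab b1 mul1g.
exists [:: (a * u)%g; v]; split=> //=; rewrite edge //= andbT.
by rewrite v_uv ab -mulgA edge.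
Qed.

Lemma random_subset_probE (T : finType) (p : R) (E : pred {set T}) :
  random_subset_prob p E = Pr (fun=> p) E.
Proof.
rewrite /random_subset_prob big_mkcond; apply: eq_bigr => S _.
by rewrite /wt; case: (E S); rewrite ?mulr1 ?mulr0.
Qed.

Lemma prob_diam_gt2E (gT : finGroupType) (p : R) :
  prob_diam_gt2 gT p = Pr (fun=> p) (@far gT).
Proof.
rewrite /prob_diam_gt2 random_subset_probE; apply: eq_Pr => S.
by rewrite ltNge diameter_le2 negbK.
Qed.

Lemma prob_diam_le2E (gT : finGroupType) (p : R) :
  prob_diam_le2 gT p = 1 - Pr (fun=> p) (@far gT).
Proof.
rewrite /prob_diam_le2 random_subset_probE -PrC; apply: eq_Pr => S.
exact: diameter_le2.
Qed.

End Diameter.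

(** * Involutions in the dihedral family *)

Section Dihedral.
Local Open Scope ring_scope.
Local Open Scope group_scope.

Lemma card_dihedral_4n n : (0 < n)%N -> #|[set: dihedral_gtype (4 * n)]| = (4 * n)%N.
Proof.
move=> n0; have -> : (4 * n = (2 * n).*2)%N by lia.
by apply: card_dihedral; lia.
Qed.

(** All [2 * n] reflections have square 1; among the rotations only 1 and [x ^+ n] do. *)
Lemma card_invols_dihedral_presentation (gT : finGroupType) n : (0 < n)%N ->
  #|[set: gT]| = (4 * n)%N ->
  [set: gT] \isog Grp (x : y : x ^+ (2 * n), y ^+ 2, x ^ y = x^-1) ->
  #|invols gT| = (2 * n + 2)%N.
Proof.
move=> n0; set G := [set: gT] => oG isoG.
have /existsP[[x y] /= /eqP[defG x2n y2 xy]] := isoGrp_hom isoG.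
have yn : <[y]> \subset 'N(<[x]>).
  by rewrite norms_cycle xy groupV cycle_id.
have defG' : G = <[x]> * <[y]> by rewrite -norm_joinEr.
have ox : (#[x] %| 2 * n)%N by rewrite order_dvdn x2n.
have oy : (#[y] %| 2)%N by rewrite order_dvdn y2.
have lex : (#[x] <= 2 * n)%N by apply: dvdn_leq ox; lia.
have ley : (#[y] <= 2)%N by apply: dvdn_leq oy.
have oxy : (#[x] * #[y] = 4 * n * #|<[x]> :&: <[y]>|)%N.
  by have := mul_cardG <[x]> <[y]>; rewrite -defG' oG.
have I0 : (0 < #|<[x]> :&: <[y]>|)%N := cardG_gt0 _.
(* The relations bound the orders from above; the group order [4 * n] forces equality. *)
have [oxE [oyE II]] : #[x] = (2 * n)%N /\ #[y] = 2 /\ #|<[x]> :&: <[y]>| = 1%N.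
  by move: lex ley oxy I0; move: #[x] #[y] #|_ :&: _| => a b c; nia.
have sub : ~: <[x]> \subset invols gT.
  apply/subsetP => z; rewrite inE => zx; have : z \in G by rewrite inE.
  rewrite defG' => /mulsgP[a b ax /cycleP[j ->] zE].
  move: zx; rewrite {}zE; rewrite -(expg_mod_order y j) oyE.
  case: (j %% 2)%N (@ltn_pmod j 2 isT) => [|[|//]] _; rewrite ?mulg1 ?ax // => _.
  case/cycleP: ax => i ->; rewrite expg1; apply/involsP.
  have yV : y^-1 = y by apply: invols_inv; rewrite inE y2.
  have : (x ^+ i) ^ y = (x ^+ i)^-1 by rewrite conjXg xy expgVn.
  rewrite conjgE yV => e; rewrite -mulgA e.
  by rewrite mulgV.
have inx : invols gT :&: <[x]> = [set 1; x ^+ n].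
  apply/setP => z; rewrite !inE; apply/andP/orP => [[+ /cycleP[i zE]]|[]/eqP->].
  - rewrite {z}zE -expgM -order_dvdn oxE mulnC dvdn_pmul2r // => /dvdnP[k ->].
    rewrite mulnC expgM /=; have xn2 : (x ^+ n) ^+ 2 = 1 by rewrite -expgM mulnC x2n.
    rewrite -(odd_double_half k) -mul2n expgD expgM xn2 expg1n mulg1.
    by case: (odd k); [right|left].
  - by rewrite expg1n group1.
  - by rewrite -expgM mulnC x2n mem_cycle.
have -> : invols gT = ~: <[x]> :|: [set 1; x ^+ n].
  apply/setP => z; rewrite -inx in_setU in_setC in_setI.
  case: (boolP (z \in <[x]>)) => zx /=; first by rewrite andbT.
  by apply: (subsetP sub); rewrite in_setC.
rewrite cardsU (_ : _ :&: _ = set0) ?cards0 ?subn0; last first.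
  apply/setP => z; rewrite in_setI in_setC in_set2 in_set0.
  by apply/negP => /andP[zx /orP[]/eqP zE]; rewrite zE ?group1 ?mem_cycle in zx.
have xn1 : x ^+ n != 1.
  by rewrite -order_dvdn oxE; apply/negP => /dvdn_leq; lia.
rewrite cards2 eq_sym xn1 /=; have : (#[x] + #|~: <[x]>| = 4 * n)%N by rewrite -oG cardsT cardsC.
by rewrite oxE; move: #|~: _| => a; lia.
Qed.

Lemma card_invols_dihedral n : (0 < n)%N ->
  #|invols (dihedral_gtype (4 * n))| = (2 * n + 2)%N.
Proof.
move=> n0; apply: card_invols_dihedral_presentation => //; first exact: card_dihedral_4n.
have -> : (4 * n = (2 * n).*2)%N by lia.
by apply: Grp_dihedral; lia.
Qed.

Lemma card_C2k k : #|{dffun forall i : 'I_k, 'Z_2}| = (2 ^ k)%N.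
Proof. by rewrite card_dep_ffun foldrE big_image /= prod_nat_const !card_ord. Qed.

Lemma card_C2k_D4n n k : (0 < n)%N -> #|C2k_D4n n k| = (2 ^ k * (4 * n))%N.
Proof.
by move=> n0; rewrite card_prod card_C2k -[X in (_ * X)%N = _]cardsT card_dihedral_4n.
Qed.

(** The elementary abelian factor multiplies both counts by [2 ^ k], so the proportion stays
    [(n + 1) / (2 * n)]. *)
Lemma card_invols_C2k_D4n n k : (0 < n)%N ->
  #|invols (C2k_D4n n k)| = (2 ^ k * (2 * n + 2))%N.
Proof.
move=> n0; rewrite -(card_invols_dihedral n0).
have -> : invols (C2k_D4n n k) = setX [set: {dffun forall i : 'I_k, 'Z_2}] (invols _).
  apply/setP => -[f d]; rewrite in_setX in_setT /=.
  apply/involsP/involsP => [[_ dd]//|dd]; congr (_, _) => //.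
  apply/ffunP => i; rewrite !ffunE.
  by case: (f i) => -[|[|//]] ?; apply/val_inj.
by rewrite cardsX cardsT card_C2k.
Qed.

End Dihedral.

(** * Thresholds *)

Local Open Scope classical_set_scope.
Local Open Scope ring_scope.

Section Threshold.
Variable R : realType.
Implicit Types (G : nat -> finGroupType) (gT : finGroupType).

Lemma near_ln_card_ge G (A : R) : #|G k| @[k --> \oo] --> \oo ->
  \forall k \near \oo, A <= ln (#|G k|%:R : R).
Proof.
move=> /cvgnyPge/(_ (Num.bound (expR A))); apply: filterS => k le_k.
rewrite -ler_expR lnK ?posrE ?card_group_gt0 //.
apply: le_trans (ltW (archi_boundP (expR_ge0 A))) _.
by rewrite ler_nat.
Qed.

Lemma kappa_ratio gT (m : nat) : (0 < m)%N ->
  (2 * m * #|invols gT| = m.+1 * #|gT|)%N -> kappa R gT = 3 / 4 - (4 * m%:R)^-1.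
Proof.
move=> m0 /(congr1 (fun k => k%:R : R)); rewrite !natrM [m.+1%:R]mulrSr => E.
have n0 := card_group_gt0 R gT; have m0' : 0 < m%:R :> R by rewrite ltr0n.
rewrite /kappa /inv_ratio.
have -> : #|invols gT|%:R = (m%:R + 1) * #|gT|%:R / (2 * m%:R) :> R.
  by rewrite -E; field; rewrite gt_eqF.
by field; rewrite !gt_eqF.
Qed.

(** The proportion [(m + 1) / (2 * m)] determines [m], which is thus the number found by
    [many_invols]. *)
Lemma many_invols_ratio gT (m : nat) : (0 < m)%N ->
  (2 * m * #|invols gT| = m.+1 * #|gT|)%N ->
  (#|gT| <= m * (2 * m) ^ m * #|central_invols gT|)%N.
Proof.
move=> m0 E; have n0 : (0 < #|gT|)%N by rewrite -(ltr0n R) card_group_gt0.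
have [|m' [m'0 E' le_n]] := @many_invols gT; first by nia.
suff -> : m = m' by [].
have : (2 * #|invols gT| * m * m' = #|gT| * (m.+1 * m'))%N by rewrite -!mulnA; nia.
have : (2 * #|invols gT| * m * m' = #|gT| * (m'.+1 * m))%N by nia.
move=> -> /eqP; rewrite eqn_pmul2l // => /eqP; lia.
Qed.

Lemma threshold_of_ratio G (m : nat) : (0 < m)%N ->
  #|G k| @[k --> \oo] --> \oo ->
  (forall k, 2 * m * #|invols (G k)| = m.+1 * #|G k|)%N ->
  diam2_threshold G ((4 * m%:R) / (3 * m%:R - 1) : R).
Proof.
move=> m0 Goo ratio; set c : R := _ / _.
have m1 : 1 <= m%:R :> R by rewrite ler1n.
have c0 : 0 < c by rewrite divr_gt0 //; lra.
have kap k : kappa R (G k) = c^-1.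
  by rewrite (kappa_ratio m0 (ratio k)) /c; field; apply/andP; split; rewrite gt_eqF //; lra.
have p01' (p : R) (k : nat) : 0 <= p <= 1 -> Pr (fun=> p) (@far (G k)) <= 1.
  by move=> p01; rewrite -subr_ge0 -PrC; apply: Pr_ge0.
split=> // eps eps0 p p01; split=> near_p; apply/cvgrPdist_le => e e0.
(* This [c'] is at least [c - eps] and satisfies [c' * kappa = 1 - eta]; the cap [1 / 2] keeps it
   positive when [eps] is large. *)
- pose eta := Num.min (eps / c) (1 / 2); pose c' := c * (1 - eta).
  have eta0 : 0 < eta by rewrite lt_min divr_gt0 //=; lra.
  have eta1 : eta <= 1 / 2 by rewrite ge_min lexx orbT.
  have c'0 : 0 < c' by rewrite mulr_gt0 //; lra.
  have [A AP] := far_likely (m * (2 * m) ^ m) c'0 eta0 e0.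
  near=> k; rewrite prob_diam_gt2E ger0_norm ?subr_ge0 ?p01' //.
  rewrite lerBlDr -lerBlDl; apply: AP => //.
  + by near: k; apply: near_ln_card_ge.
  + apply: (@le_trans _ _ (critical_prob (c - eps) (G k))); first by near: k.
    rewrite ler_wsqrtr // ler_wpM2r ?divr_ge0 ?ler0n ?ln_ge0 //.
      by rewrite ler1n -(ltr0n R) card_group_gt0.
    have : c * eta <= c * (eps / c) by rewrite ler_pM2l // ge_min lexx.
    by rewrite mulrCA divff ?gt_eqF // mulr1 /c'; lra.
  + by rewrite kap /c' mulrAC divff ?gt_eqF // mul1r.
  + exact: many_invols_ratio.
- have [A AP] := far_unlikely (addr_gt0 c0 eps0) (divr_gt0 eps0 c0) e0.
  near=> k; rewrite prob_diam_le2E opprB addrC subrK ger0_norm; last exact: Pr_ge0.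
  apply: AP => //.
  + by near: k; apply: near_ln_card_ge.
  + by near: k.
  + by rewrite kap mulrDl divff ?gt_eqF.
Unshelve. all: by end_near.
Qed.

(* [3 / 4 - 1 / (4 m)] increases to [3 / 4], so a number below [3 / 4] that is
   not of this form is at positive distance from all of these values. *)
Lemma kappa_gap (a : R) : a < 3 / 4 ->
  (forall m : nat, (0 < m)%N -> a != 3 / 4 - (4 * m%:R)^-1) ->
  exists (gam : R) (M : nat), [/\ 0 < gam, a + gam <= 3 / 4 &
    forall m : nat, (0 < m)%N ->
      (m <= M)%N /\ 3 / 4 - (4 * m%:R)^-1 <= a - gam \/
      a + gam <= 3 / 4 - (4 * m%:R)^-1].
Proof.
pose kap m : R := 3 / 4 - (4 * m%:R)^-1 => a34 neq_a.
have kapS m m' : (0 < m)%N -> (m <= m')%N -> kap m <= kap m'.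
  move=> m0 mm'; rewrite lerD2l lerN2 lef_pV2 ?posrE ?mulr_gt0 ?ltr0n //.
    by rewrite ler_pM2l // ler_nat.
  exact: leq_trans mm'.
have ex : exists m, (0 < m)%N && (a < kap m).
  have d0 : 0 < 4 * (3 / 4 - a) by lra.
  have b0 : 0 <= (4 * (3 / 4 - a))^-1 by rewrite invr_ge0 ltW.
  exists (Num.bound (4 * (3 / 4 - a))^-1).+1; apply/andP; split=> //; rewrite /kap.
  have := archi_boundP b0; set b := Num.bound _ => ltb.
  have {}ltb : (4 * (3 / 4 - a))^-1 < b.+1%:R.
    by apply: lt_le_trans ltb _; rewrite ler_nat.
  have b1 : 0 < b.+1%:R :> R by rewrite ltr0n.
  suff : (4 * b.+1%:R)^-1 < 3 / 4 - a by rewrite ltrBrDr ltrBrDl addrC.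
  rewrite invf_plt ?posrE ?mulr_gt0 //; last lra.
  have -> : (3 / 4 - a)^-1 = 4 * (4 * (3 / 4 - a))^-1.
    by rewrite invfM mulrA divff // mul1r.
  by rewrite ltr_pM2l.
case: (ex_minnP ex) => m0 /andP[m00 am0] minm0.
have kap34 : kap m0 <= 3 / 4 by rewrite gerBl invr_ge0 mulr_ge0 ?ler0n.
have low m : (0 < m)%N -> (m < m0)%N -> kap m < a.
  move=> m_0 mm0; rewrite lt_neqAle eq_sym neq_a //= leNgt; apply/negP => am.
  by have := minm0 m; rewrite m_0 am leqNgt mm0 => /(_ isT).
(* The distance from [a] to the nearest value on each side; for [m0 = 1] there is none below, and 1
   is a dummy. *)
pose gam := Num.min (kap m0 - a) (if m0 == 1%N then 1 else a - kap m0.-1).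
exists gam, m0; split.
- rewrite lt_min subr_gt0 am0; case: eqP => //= m01.
  by rewrite subr_gt0 low; lia.
- have : gam <= kap m0 - a by rewrite ge_min lexx.
  lra.
- move=> m m_0; case: (ltnP m m0) => mm0; [left|right].
    split; first exact: ltnW.
    have : gam <= a - kap m0.-1.
      by rewrite /gam; case: eqP => [m01|_]; [lia|rewrite ge_min lexx orbT].
    have : kap m <= kap m0.-1 by apply: kapS => //; lia.
    rewrite -/(kap m); lra.
  have : gam <= kap m0 - a by rewrite ge_min lexx.
  have := kapS _ _ m00 mm0; rewrite -/(kap m); lra.
Qed.

(** Otherwise [c^-1] is at distance at least [gam] from every possible [kappa] up to [3 / 4]. For
    one large [k], either [kappa] is larger and the diameter is likely at most 2 already at
    [c - eps], or it is smaller and the diameter likely exceeds 2 still at [c + eps]. *)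
Lemma threshold_values G (c : R) : 4 / 3 < c -> diam2_threshold G c ->
  exists n : nat, (0 < n)%N /\ c = (4 * n%:R) / (3 * n%:R - 1).
Proof.
move=> c43 [Goo c0 thr]; apply: contrapT => nex.
have a34 : c^-1 < 3 / 4 by rewrite invf_plt ?posrE //; lra.
have [m m0|gam [M [gam0 gam34 gap]]] := kappa_gap a34.
  apply/eqP => aE; apply: nex; exists m; split=> //.
  have m1 : 1 <= m%:R :> R by rewrite ler1n.
  rewrite -[c]invrK aE; field; apply/andP; split; rewrite gt_eqF //; lra.
set a := c^-1 in a34 gam34 gap; have a0 : 0 < a by rewrite invr_gt0.
have ca : c * a = 1 by rewrite divff // gt_eqF.
(* Chosen so that [(c - eps) * (a + gam) = 1 + eta] and [(c + eps) * (a - gam) <= 1 - eta]. *)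
pose eps := c * gam / (2 * (a + gam)); pose eta := c * gam / 2.
have ag0 : 0 < a + gam by lra.
have cg0 : 0 < c * gam by rewrite mulr_gt0.
have eta0 : 0 < eta by rewrite divr_gt0.
have eps0 : 0 < eps by rewrite divr_gt0 // mulr_gt0.
have epsE : eps * (a + gam) = eta by rewrite /eps /eta; field; rewrite gt_eqF.
have cm0 : 0 < c - eps.
  by rewrite -(pmulr_lgt0 _ ag0) mulrBl epsE mulrDr ca /eta; lra.
have cp0 : 0 < c + eps by lra.
have t0 : 0 < 1 / 3 :> R by lra.
have [A1 A1P] := far_unlikely cm0 eta0 t0.
have [A2 A2P] := far_likely (M * (2 * M) ^ M) cp0 eta0 t0.
have [A3 A3P] := critical_prob_small cp0 ltr01.
(* The cap makes this a probability for every [k]; it is inactive for large [k]. *)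
pose pr (c' : R) k : R := Num.min 1 (critical_prob c' (G k)).
have pr01 c' k : 0 <= pr c' k <= 1 by rewrite le_min ler01 sqrtr_ge0 ge_min lexx.
have [thr1 _] := thr eps eps0 _ (pr01 (c - eps)).
have [_ thr2] := thr eps eps0 _ (pr01 (c + eps)).
have big := near_ln_card_ge _ Goo.
have near3 : \forall k \near \oo, pr (c + eps) k = critical_prob (c + eps) (G k).
  apply: filterS (big A3) => k /A3P[_ q1 _]; exact: min_r.
have /cvgrPdist_lt/(_ _ t0) lim1 :
    prob_diam_gt2 (G k) (pr (c - eps) k) @[k --> \oo] --> (1 : R).
  by apply: thr1; apply: nearW => k; rewrite /pr ge_min lexx orbT.
have /cvgrPdist_lt/(_ _ t0) lim2 :
    prob_diam_le2 (G k) (pr (c + eps) k) @[k --> \oo] --> (1 : R).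
  by apply: thr2; apply: filterS near3 => k ->.
have [k [[[gt2 le2] [B1 B2]] B3]] := filter_ex (filterI (filterI (filterI lim1 lim2)
  (filterI (big A1) (big A2))) (big A3)).
rewrite prob_diam_gt2E ltr_norml in gt2; rewrite prob_diam_le2E ltr_norml in le2.
have [L0 q1 _] := A3P _ B3.
have crit_le1 : critical_prob (c - eps) (G k) <= 1.
  apply: le_trans q1; rewrite ler_wsqrtr // ler_wpM2r ?divr_ge0 ?ler0n //; lra.
have up : a + gam <= kappa R (G k) -> False.
  move=> kap; have := A1P _ (pr (c - eps) k) B1 (pr01 _ _).
  rewrite {1}/pr min_r // lexx => /(_ isT) far_le.
  suff /far_le : 1 + eta <= (c - eps) * kappa R (G k) by lra.
  have : (c - eps) * (a + gam) <= (c - eps) * kappa R (G k) by rewrite ler_pM2l.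
  by rewrite mulrBl epsE mulrDr ca /eta; lra.
(* If at most half of the elements have square 1, then [kappa >= 3 / 4 >= a + gam]. *)
have [half|half] := ltnP #|G k| (2 * #|invols (G k)|)%N; last first.
  apply: up; apply: le_trans gam34 _; rewrite /kappa /inv_ratio.
  have : #|invols (G k)|%:R / #|G k|%:R <= 1 / 2 :> R.
    rewrite ler_pdivrMr ?card_group_gt0 //.
    by move: half; rewrite -(ler_nat R) natrM; lra.
  lra.
have [m [m0 mE le_n]] := many_invols half.
have [[mM kap]|] := gap m m0; last by rewrite -(kappa_ratio m0 mE).
rewrite -(kappa_ratio m0 mE) in kap.
have := A2P _ (pr (c + eps) k) B2 (pr01 _ _).
rewrite {1}/pr ge_min lexx orbT => /(_ isT) far_ge.
suff /far_ge : (c + eps) * kappa R (G k) <= 1 - eta.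
  (* As [m <= M], the index bound from [many_invols] is at most the constant [M * (2 * M) ^ M] fixed
     before [k]. *)
  move=> far_ge'; have {far_ge'} : 1 - 1 / 3 <= Pr (fun=> pr (c + eps) k) (@far (G k)).
    apply: far_ge'; apply: leq_trans le_n _; rewrite leq_mul2r; apply/orP; right.
    apply: leq_mul => //; apply: leq_trans (_ : (2 * m) ^ M <= _)%N.
      by rewrite leq_pexp2l // muln_gt0.
    by case: (posnP M) => [->//|M0]; rewrite leq_exp2r // leq_mul2l mM.
  lra.
have : (c + eps) * kappa R (G k) <= (c + eps) * (a - gam) by rewrite ler_pM2l.
have : 0 <= eps * gam by rewrite mulr_ge0 ?ltW.
have -> : (c + eps) * (a - gam) = 1 - c * gam + eps * (a - gam).
  by rewrite mulrDl mulrBr ca.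
by move: epsE; rewrite mulrDr /eta; lra.
Qed.

End Threshold.

Theorem theorem1p5 (R : realType) :
  (forall (G : nat -> finGroupType) (c : R),
     4 / 3 < c -> diam2_threshold G c ->
     exists n : nat, (0 < n)%N /\ c = (4 * n%:R) / (3 * n%:R - 1)) /\
  (forall n : nat, (0 < n)%N ->
     diam2_threshold (C2k_D4n n) ((4 * n%:R) / (3 * n%:R - 1) : R)).
Proof.
split=> [G c|n n0]; first exact: threshold_values.
apply: threshold_of_ratio => // [|k]; last first.
  by rewrite card_C2k_D4n // card_invols_C2k_D4n //; lia.
apply/cvgnyPge => N; exists N => // k /= Nk.
rewrite card_C2k_D4n //; have := ltn_expl k (isT : (1 < 2)%N).
by move: (2 ^ k)%N => w; nia.
Qed.
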